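(* Let $\mu_\pi$ be a complete quotient Cantor-like measure that admits a block positive transition matrix. Then each of the sets $\{\dim_{loc}\mu_\pi(x):x\in\mathbb{T}\}$, $\{\overline{\dim}_{loc}\mu_\pi(x):x\in\mathbb{T}\}$ and $\{\underline{\dim}_{loc}\mu_\pi(x):x\in\mathbb{T}\}$ is the closed interval which is the closure of the set of local dimensions of $\mu_\pi$ at block diagonal, positive, interior periodic points. In particular, let $d\ge 3$ and $k\geq d-1$ be integers, let $\mu$ be the self-similar measure associated with the IFS $\{S_j(x)=\frac1dx+\frac{j(d-1)}{d}:j\in\{0,1,\dots,k\}\}$ and probabilities $p_j>0$, $\sum_{j=0}^k p_j=1$, and let $\mu_\pi$ be its quotient on $\mathbb{T}$. Then the set of local dimensions of $\mu_\pi$ is a closed interval.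
   Context: Setting. Let $d\ge3$, $k\ge d-1$ be integers, $\Lambda\subseteq\{0,1,\dots,k\}$ with $0,k\in\Lambda$, and $p_j>0$ ($j\in\Lambda$) with $\sum_{j\in\Lambda}p_j=1$. Let $S_j(x)=\frac1dx+\frac{j(d-1)}{d}$, $j\in\Lambda$. $K$ is the self-similar set (unique non-empty compact set with $K=\bigcup_{j\in\Lambda}S_j(K)$; its convex hull is $[0,k]$) and $\mu$ the self-similar measure ($\mu=\sum_{j\in\Lambda}p_j\,\mu\circ S_j^{-1}$). $\mathbb{T}=\mathbb{R}/\mathbb{Z}$, $\pi:\mathbb{R}\to\mathbb{T}$ is the quotient map, and $\mu_\pi(E)=\mu(\pi^{-1}(E))$. Put $S_\sigma=S_{\sigma_1}\circ\cdots\circ S_{\sigma_n}$ for $\sigma\in\Lambda^n$. Quotient net intervals and neighbours. For $n\ge1$, identify $\mathbb{T}$ with $[0,1)$, list the elements of $\{\pi(S_\sigma(0)),\pi(S_\sigma(k)):\sigma\in\Lambda^n\}$ as $0=h_1<\dots<h_{s-1}<1$ and put $h_s=1$. The quotient net intervals of level $n$ are the intervals $[h_i,h_{i+1}]$ with $\pi^{-1}((h_i,h_{i+1}))\cap K\ne\emptyset$. The normalized length of such $\Delta=[a,b]$ is $d^n(b-a)$, and its quotient neighbour set is the set, listed increasingly, of all numbers $d^n(a+l-S_\sigma(0))$ with $\sigma\in\Lambda^n$ and $l$ a non-negative integer such that $(a+l,b+l)\cap S_\sigma(K)\ne\emptyset$. Complete quotient Cantor-like measure. $\mu_\pi$ is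 so called if for every $n\ge1$ the quotient net intervals of level $n$ are exactly $[jd^{-n},(j+1)d^{-n}]$, $j=0,\dots,d^n-1$, and each of them has quotient neighbour set $(0,1,\dots,k-1)$. (Its support is then $\mathbb{T}$.) Transition matrices. The primitive transition matrices are the $k\times k$ matrices $T(\ell)$, $\ell=0,\dots,d-1$, with $T(\ell)_{ji}=p_s$ if $s:=\frac{\ell-(i-1)+(j-1)d}{d-1}\in\Lambda$ and $T(\ell)_{ji}=0$ otherwise ($1\le i,j\le k$). The permuted matrix $\widetilde T(\ell)$ is partitioned into blocks $(i,j)$, $i,j\in\{1,\dots,d-1\}$, block $(i,j)$ having size $(\lfloor\frac{k-i}{d-1}\rfloor+1)\times(\lfloor\frac{k-j}{d-1}\rfloor+1)$, and its $(i',j')$ entry (indices starting at $0$) is $T(\ell)_{i+i'(d-1),\,j+j'(d-1)}$. For a word $w=(\ell_1,\dots,\ell_m)$, $m\geq 1$, in $\{0,\dots,d-1\}$ put $\widetilde T(w)=\widetilde T(\ell_1)\cdots\widetilde T(\ell_m)$; these are the (permuted) transition matrices. Block terminology. For a matrix $B$ partitioned in this way, $B(i,j)$ denotes its $(i,j)$ block. $B$ is a block matrix of type $r$ if $B(i,j)=0$ unless $j-i\equiv r\pmod{d-1}$ and, for all $i,j$ with $j-i\equiv r\pmod{d-1}$, $B(i,j)$ has a non-zero entry in each row and column. Every $\widetilde T(w)$ is a block matrix, of type $\ell_1+\dots+\ell_m$. $B$ is block diagonal if it is of type $0$; it is block positive if for some $r$ it is of type $r$ and all entries of $B(i,j)$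 are strictly positive whenever $j-i\equiv r\pmod{d-1}$. ''Admits a block positive transition matrix'' means some $\widetilde T(w)$ is block positive. Periodic points. A point $x\in\mathbb{T}$ is periodic with period $w=(\ell_1,\dots,\ell_m)$ if $x=\pi(\sum_{n\ge1}e_nd^{-n})$ for some digit sequence $(e_n)$ in $\{0,\dots,d-1\}$ consisting of a finite initial word followed by infinitely many repetitions of $w$. It is an interior periodic point if it is not an endpoint of a quotient net interval, i.e. $x\ne\pi(jd^{-n})$ for all integers $j$ and $n\ge0$. It is a block diagonal, positive periodic point if it has a period $w$ with $\widetilde T(w)$ block diagonal and block positive. Local dimensions. $\overline{\dim}_{loc}\mu_\pi(x)$ and $\underline{\dim}_{loc}\mu_\pi(x)$ are the $\limsup$ and $\liminf$ as $r\to0$ of $\log\mu_\pi(B(x,r))/\log r$ (balls in the usual metric of $\mathbb{T}$); when they coincide the common value is $\dim_{loc}\mu_\pi(x)$. The set $\{\dim_{loc}\mu_\pi(x)\}$ is taken over the points where the local dimension exists. *)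

(* Defs.v *)
From HB Require Import structures.
From mathcomp Require Import all_boot all_order all_algebra.
From mathcomp Require Import generic_quotient.
From mathcomp Require Import all_classical all_reals all_analysis.

Set Implicit Arguments.
Unset Strict Implicit.
Unset Printing Implicit Defensive.

Import Order.TTheory GRing.Theory Num.Theory.
Import numFieldNormedType.Exports.

Local Open Scope classical_set_scope.
Local Open Scope ring_scope.
Local Open Scope quotient_scope.

Section Circle.
Variable R : realType.

Definition int_diff (x y : R) : bool := x - y \is a Num.int.

Lemma int_diff_refl : reflexive int_diff.
Proof. by move=> x; rewrite /int_diff subrr rpred0. Qed.

Lemma int_diff_sym : symmetric int_diff.
Proof. by move=> x y; rewrite /int_diff -opprB rpredN. Qed.

Lemma int_diff_trans : transitive int_diff.
Proof.
move=> y x z xy yz; rewrite /int_diff -(subrKA y x (- z)); exact: rpredD.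
Qed.

Canonical int_diff_equiv :=
  EquivRel int_diff int_diff_refl int_diff_sym int_diff_trans.

Definition circle := {eq_quot int_diff_equiv}.

Definition circle_proj (x : R) : circle := \pi_circle x.

Definition unit_rep (x : circle) : R := repr x - (Num.floor (repr x))%:~R.

Definition circle_dist (x y : circle) : R :=
  inf [set `|a - b| | a in circle_proj @^-1` [set x] & b in circle_proj @^-1` [set y]].

Definition circle_ball (x : circle) (r : R) : set circle :=
  [set y | circle_dist x y < r].

End Circle.

Section LocalDimension.
Variables (R : realType) (nu : set (circle R) -> \bar R).
Local Open Scope ereal_scope.

(* [lne 0 = -oo], so the quotient is [+oo] on a null ball of radius < 1. *)
Definition dim_quotient (x : circle R) (r : R) : \bar R :=
  lne (nu (circle_ball x r)) * ((ln r)^-1)%:E.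

Definition upper_locdim (x : circle R) : \bar R :=
  limf_esup (dim_quotient x) (0 : R)^'+.

Definition lower_locdim (x : circle R) : \bar R :=
  limf_einf (dim_quotient x) (0 : R)^'+.

Definition has_locdim (x : circle R) (v : \bar R) : Prop :=
  upper_locdim x = v /\ lower_locdim x = v.

Definition locdims_on (E : set (circle R)) : set (\bar R) :=
  [set v | exists2 x, E x & has_locdim x v].

End LocalDimension.

Section SelfSimilar.
Variables (R : realType) (d k : nat) (Lam : {set 'I_k.+1}) (p : 'I_k.+1 -> R).

Definition simS (j : 'I_k.+1) (x : R) : R :=
  x / d%:R + (j * d.-1)%:R / d%:R.

Definition self_similar_set (K : set R) : Prop :=
  [/\ compact K, K !=set0 & K = \bigcup_(j in [set` Lam]) (simS j @` K)].

Definition self_similar_measure (mu : probability (measurableTypeR R) R) :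
    Prop :=
  forall A : set (measurableTypeR R), measurable A ->
    mu A = (\sum_(j in Lam) (p j)%:E * mu (simS j @^-1` A))%E.

Definition quotient_measure (mu : probability (measurableTypeR R) R)
    (E : set (circle R)) : \bar R :=
  mu (@circle_proj R @^-1` E).

Definition words (n : nat) : seq (n.-tuple 'I_k.+1) :=
  enum [pred s : n.-tuple 'I_k.+1 | all (mem Lam) s].

Definition simSw (s : seq 'I_k.+1) (x : R) : R := foldr simS x s.

(* The list h_1 < ... < h_(s-1), without the final h_s = 1. *)
Definition endpoints (n : nat) : seq R :=
  sort <=%R (undup
    ([seq unit_rep (circle_proj (simSw (tval s) 0)) | s <- words n] ++
     [seq unit_rep (circle_proj (simSw (tval s) k%:R)) | s <- words n])).

(* The interval [a, b] is encoded as the pair (a, b). *)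
Definition net_intervals (K : set R) (n : nat) : set (R * R) :=
  let h := rcons (endpoints n) 1 in
  [set D | exists2 i : nat, (i < size (endpoints n))%N &
     D = (h`_i, h`_i.+1) /\
     (@circle_proj R @^-1` (@circle_proj R @` `]h`_i, h`_i.+1[)) `&` K !=set0].

Definition neighbour_set (K : set R) (n : nat) (D : R * R) : set R :=
  [set y | exists (s : n.-tuple 'I_k.+1) (l : nat),
     [/\ s \in words n,
         `]D.1 + l%:R, D.2 + l%:R[ `&` (simSw (tval s) @` K) !=set0 &
         y = d%:R ^+ n * (D.1 + l%:R - simSw (tval s) 0)]].

Definition adic_interval (n j : nat) : R * R :=
  (j%:R / d%:R ^+ n, j.+1%:R / d%:R ^+ n).

Definition complete_cantor_like (K : set R) : Prop :=
  forall n : nat, (0 < n)%N ->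
    net_intervals K n = [set adic_interval n j | j in `I_(d ^ n)] /\
    forall D, net_intervals K n D ->
      neighbour_set K n D = [set i%:R | i in `I_k].

(* Entry in row j and column i of the k x k matrix T(l), with rows and columns
   numbered from 0, so that (i - 1) and (j - 1) become i and j.  The equation
   determines s, since d > 1. *)
Definition trans_entry (l j i : nat) : R :=
  if [pick s in Lam | (s * d.-1 + i == l + j * d)%N] is Some s then p s else 0.

(* Block indices are also numbered from 0: this is
   floor((k - (i + 1)) / (d - 1)) + 1. *)
Definition block_size (i : 'I_d.-1) : nat := ((k - i.+1) %/ d.-1).+1.

Definition block_matrix := 'M[R]_(\sum_i block_size i).

Definition permuted_trans (l : 'I_d) : block_matrix :=
  \mxblock_(i, j) \matrix_(i' < block_size i, j' < block_size j)
    trans_entry l (i + i' * d.-1) (j + j' * d.-1).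

Definition permuted_trans_word (w : seq 'I_d) : block_matrix :=
  \big[mulmx/1%:M]_(l <- w) permuted_trans l.

Definition blk (B : block_matrix) (i j : 'I_d.-1) :
    'M[R]_(block_size i, block_size j) :=
  submxblock B i j.

Definition block_type (r : nat) (B : block_matrix) : Prop :=
  forall i j : 'I_d.-1,
    if (i + r == j %[mod d.-1])%N then
      (forall i', exists j', blk B i j i' j' != 0) /\
      (forall j', exists i', blk B i j i' j' != 0)
    else blk B i j = 0.

Definition block_diagonal (B : block_matrix) : Prop := block_type 0 B.

Definition block_positive (B : block_matrix) : Prop :=
  exists2 r : nat, block_type r B &
    forall i j : 'I_d.-1, (i + r == j %[mod d.-1])%N ->
      forall i' j', 0 < blk B i j i' j'.

Definition admits_block_positive : Prop :=
  exists2 w : seq 'I_d, w != [::] & block_positive (permuted_trans_word w).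

(* [e n] is the digit e_(n+1). *)
Definition digit_point (e : nat -> 'I_d) : circle R :=
  circle_proj (limn (series (fun n => (e n)%:R / d%:R ^+ n.+1 : R))).

Definition has_period (x : circle R) (w : seq 'I_d) : Prop :=
  w != [::] /\
  exists e : nat -> 'I_d, x = digit_point e /\
    exists N : nat, forall n, onth w (n %% size w) = Some (e (N + n)%N).

Definition interior_point (x : circle R) : Prop :=
  forall (j : int) (n : nat), x <> circle_proj (j%:~R / d%:R ^+ n).

Definition block_diag_pos_interior_periodic (x : circle R) : Prop :=
  interior_point x /\
  exists2 w, has_period x w &
    block_diagonal (permuted_trans_word w) /\ block_positive (permuted_trans_word w).

End SelfSimilar.

(* Main.v *)
(* Write M(w) for the sum of the entries of the product T(w) of the unpermuted
   transition matrices and f = ln M.  The measure of the adic interval coded by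
   w is comparable to M(w), and f is subadditive.  A block positive T(B) stays
   block positive when B is followed by any word, so among the words B.1.r every
   residue of the total digit sum mod d - 1 occurs; picking the residue that
   joins the heaviest residue class of rows of T(u) to that of T(v) yields a
   connector z of bounded length with f(u z v) >= f(u) + f(v) - C.  Let E1 and E2
   be the growth rates of the minimum and the maximum of f over words of length
   n.  Every local dimension lies in [- E2 / ln d, - E1 / ln d], because a ball of
   radius d^-n contains an adic interval of level n + 1 and meets only three of
   level n.  Conversely, for t in [E1, E2], greedy concatenation of light and
   heavy words with connectors gives a digit sequence with f(e_1 ... e_n) ~ t n;
   closing up a long prefix with a connector gives block diagonal, positive
   periodic points whose exponent is close to t.  The digit 1 in each connector
   separates the point from the ends of its adic intervals often enough for
   balls and adic intervals to have the same exponents. *)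

Require Import Defs.
From HB Require Import structures.
From mathcomp Require Import all_boot all_order all_algebra.
From mathcomp Require Import all_classical all_reals all_analysis.
From mathcomp Require Import measurable_realfun ring lra zify.

Set Implicit Arguments.
Unset Strict Implicit.
Unset Printing Implicit Defensive.

Import Order.TTheory GRing.Theory Num.Theory.
Import numFieldNormedType.Exports.

Local Open Scope classical_set_scope.
Local Open Scope ring_scope.

(** * Words with a subadditive weight *)

(** Two features of the matrices shape the argument. A product T(w) is never positive: its entries
    live on a single residue pattern mod d - 1, so the mass of T(u) may arrive in a residue class
    where T(v) has very little. No single connector serves all pairs of words; one is kept for each
    residue. Moreover a row of T(l) may vanish, whereas every column has an entry of size at least q
    > 0. Hence positivity is kept by appending words and not by prepending them, and the lower bound
    q^n on M(w) is a bound on columns. Completeness enters through this column property, which is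
    read off the neighbour sets of level 1; for the full digit set it is checked directly, and the
    word 1...1 of length k serves as B. In the greedy construction every connector costs a bounded
    amount, and the blocks get longer, so the total cost is negligible against the length. The
    exponent t is then reached exactly, the end values E1 and E2 included, while a closed-up prefix
    carries an error of order 1/length; this is why the periodic points only yield a dense set. *)

Lemma archi_ge (R : realType) (x : R) : exists n : nat, x <= n%:R.
Proof.
exists (Num.truncn `|x|).+1.
by rewrite (le_trans (ler_norm x)) // ltW // truncnS_gt.
Qed.

(** The rate is the infimum of [a n / n]: if [p] nearly attains it, then [n = q p + r] gives
    [a n <= q * a p + a r], and the remainder stays bounded while [n] grows. *)
Lemma fekete (R : realType) (a : nat -> R) (Q : R) :
  (forall m n, a (m + n)%N <= a m + a n) ->
  (forall n, - Q * n%:R <= a n) ->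
  exists E : R, (forall n, E * n%:R <= a n) /\
    forall eps : R, 0 < eps -> exists n0 : nat, forall n, (n0 <= n)%N ->
      a n <= (E + eps) * n%:R.
Proof.
move=> sub lb.
pose S : set R := [set a n.+1 / n.+1%:R | n in setT].
have lbS : lbound S (- Q).
  by move=> _ [n _ <-]; rewrite ler_pdivlMr ?ltr0n //; exact: lb.
have infS : has_inf S by split; [exists (a 1%N / 1%:R); exists 0%N | exists (- Q)].
exists (inf S); split.
  case=> [|n]; first by rewrite mulr0; have := sub 0%N 0%N; rewrite addn0; lra.
  rewrite -ler_pdivlMr ?ltr0n //; apply: ge_inf; first by exists (- Q).
  by exists n.
move=> eps eps0; have e2 : 0 < eps / 2 by lra.
have [_ [p' _ <-]] := inf_adherent e2 infS.
set E := inf S; set p := p'.+1; have p0 : 0 < p%:R :> R by rewrite ltr0n.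
rewrite ltr_pdivrMr // => /ltW ap.
(* [B] bounds [a r] for every remainder [r < p], and the second term of the numerator pays for
   replacing [q p] by [n]; [n0] absorbs both into the spare [eps / 2]. *)
pose B := \sum_(r < p) `|a r|.
have [n0 Hn0] := archi_ge ((B + p%:R * `|E + eps / 2|) / (eps / 2)).
exists n0 => n n0n.
have qa q r : a (q * p + r)%N <= q%:R * a p + a r.
  elim: q => [|q IH]; first by rewrite mul0r add0r.
  rewrite mulSn -addnA (le_trans (sub _ _)) // -natr1 mulrDl mul1r.
  by rewrite [_ * _ + a p]addrC -addrA lerD2l.
have rp : (n %% p < p)%N by rewrite ltn_mod.
have aB : a (n %% p)%N <= B.
  rewrite (le_trans (ler_norm _)) // /B (bigD1 (Ordinal rp)) //=.
  by rewrite lerDl sumr_ge0.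
have nE : n%:R = (n %/ p)%:R * p%:R + (n %% p)%:R :> R.
  by rewrite -natrM -natrD -divn_eq.
have rpR : (n %% p)%:R <= p%:R :> R by rewrite ler_nat ltnW.
have r0 : 0 <= (n %% p)%:R :> R by [].
have {}Hn0 : B + p%:R * `|E + eps / 2| <= eps / 2 * n%:R.
  rewrite [eps / 2 * _]mulrC -ler_pdivrMr // (le_trans Hn0) // ler_nat //.
have qap : (n %/ p)%:R * a p <= (n %/ p)%:R * ((E + eps / 2) * p%:R).
  by rewrite ler_wpM2l.
rewrite {1}(divn_eq n p) (le_trans (qa _ _)) //.
have rE : - (n %% p)%:R * (E + eps / 2) <= p%:R * `|E + eps / 2|.
  rewrite (le_trans (ler_norm _)) // normrM normrN (ger0_norm r0).
  by rewrite ler_wpM2r.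
rewrite mulrDl; move: rE qap; rewrite -/E.
have : (E + eps/2) * n%:R + eps / 2 * n%:R = E * n%:R + eps * n%:R by lra.
rewrite {1}nE; nra.
Qed.

(* [e] has symbolic exponent [t], and the digit [o] occurs with gaps negligible
   against the position. *)
Definition regular (R : realType) (A : eqType) (f : seq A -> R) (o : A)
    (e : nat -> A) (t : R) : Prop :=
  (forall eps : R, 0 < eps -> exists n0 : nat, forall n, (n0 <= n)%N ->
     `|f (mkseq e n) - t * n%:R| <= eps * n%:R) /\
  (forall eps : R, 0 < eps -> exists n0 : nat, forall n, (n0 <= n)%N ->
     exists p : nat, [/\ (p < n)%N, (1 - eps) * n%:R <= p%:R & e p = o]).

Section Chain.
Variables (A : eqType) (o : A).

Lemma size_chain (y tail : nat -> seq A) :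
  y 0%N = [::] -> (forall k, y k.+1 = y k ++ tail k) ->
  (forall k, o \in tail k) -> forall k, (k <= size (y k))%N.
Proof.
move=> y0 yS ot; elim=> // k IH; rewrite yS size_cat.
by have := ot k; case: (tail k) => //= a s _; lia.
Qed.

Lemma chain_seq (y tail : nat -> seq A) :
  y 0%N = [::] -> (forall k, y k.+1 = y k ++ tail k) ->
  (forall k, o \in tail k) ->
  exists e : nat -> A, forall k n, (n <= size (y k))%N -> mkseq e n = take n (y k).
Proof.
(* The prefix [y n.+1] has more than [n] letters, so the default [o] is never read. *)
move=> y0 yS ot; pose e n := nth o (y n.+1) n; exists e => k n nk.
have pre i j : (i <= j)%N -> exists s, y j = y i ++ s.
  move=> /subnKC <-; elim: (j - i)%N => [|m [s IH]].
    by exists [::]; rewrite addn0 cats0.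
  by exists (s ++ tail (i + m)%N); rewrite addnS yS IH catA.
apply: (@eq_from_nth _ o); first by rewrite size_mkseq size_takel.
move=> i; rewrite size_mkseq => lin; rewrite nth_mkseq // nth_take // /e.
have ii : (i < size (y i.+1))%N := size_chain y0 yS ot i.+1.
have ik : (i < size (y k))%N := leq_trans lin nk.
by have [/pre[s ->]|/ltnW/pre[s ->]] := leqP i.+1 k; rewrite nth_cat ?ii ?ik.
Qed.

End Chain.

Section Words.
Variables (R : realType) (A : finType) (o : A) (f : seq A -> R) (C Q : R).
Hypothesis f_cat : forall u v, f (u ++ v) <= f u + f v.
Hypothesis f_le : forall u, f u <= C.
Hypothesis f_ge : forall u, - Q * (size u)%:R <= f u.

Let C_ge0 : 0 <= C.
Proof. by apply: le_trans (f_le [::]); have := f_ge [::]; rewrite mulr0. Qed.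

(** Values at the stages pin [f] in between: appending letters raises [f] by at most [C], so a
    prefix [x] between [y k] and [y k.+1] has [f (y k.+1) - C <= f x <= f (y k) + C]. Since tails
    are short relative to stages, the exponent passes to all prefixes. *)
Lemma chain_regular (y tail : nat -> seq A) (t : R) :
  y 0%N = [::] -> (forall k, y k.+1 = y k ++ tail k) ->
  (forall k, o \in tail k) ->
  (forall eps : R, 0 < eps -> exists k0 : nat, forall k, (k0 <= k)%N ->
     (size (tail k))%:R <= eps * (size (y k))%:R) ->
  (forall eps : R, 0 < eps -> exists k0 : nat, forall k, (k0 <= k)%N ->
     `|f (y k) - t * (size (y k))%:R| <= eps * (size (y k))%:R) ->
  exists e : nat -> A,
    (forall k n, (n <= size (y k))%N -> mkseq e n = take n (y k)) /\
    regular f o e t.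
Proof.
move=> y0 yS ot tl fl.
have [e He] := chain_seq y0 yS ot; exists e; split=> //.
have szS k : size (y k.+1) = (size (y k) + size (tail k))%N.
  by rewrite yS size_cat.
have szk := size_chain y0 yS ot.
have szM i j : (i <= j)%N -> (size (y i) <= size (y j))%N.
  move=> /subnKC <-; elim: (j - i)%N => [|m IH]; first by rewrite addn0.
  by rewrite addnS szS (leq_trans IH) // leq_addr.
have loc n : exists k, (size (y k) <= n < size (y k.+1))%N.
  elim: n => [|n [k /andP[k1 k2]]].
    by exists 0%N; rewrite y0 /= (leq_trans _ (szk 1%N)).
  have [lt|ge] := ltnP n.+1 (size (y k.+1)).
    by exists k; rewrite lt (leq_trans k1).
  exists k.+1; rewrite ge /= (leq_ltn_trans k2) // [ltnRHS]szS -[ltnLHS]addn0.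
  by rewrite ltn_add2l; have := ot k.+1; case: (tail k.+1).
have loc_ge k0 n k : (size (y k0) <= n)%N -> (n < size (y k.+1))%N -> (k0 <= k)%N.
  by move=> h1 h2; rewrite leqNgt; apply/negP => /szM; lia.
split=> eps eps0.
- pose e1 := Num.min 1 (eps / (4 * (`|t| + 1))).
  have t0 := normr_ge0 t.
  have e10 : 0 < e1 by rewrite lt_min ltr01 divr_gt0 //; lra.
  have e1t : e1 * (4 * (`|t| + 1)) <= eps.
    rewrite -ler_pdivlMr ?ge_min ?lexx ?orbT //; lra.
  have e11 : e1 <= 1 by rewrite ge_min lexx.
  have [k1 H1] := tl _ e10; have [k2 H2] := fl _ e10.
  have [n1 Hn1] := archi_ge (C / (eps / 4)).
  exists (maxn n1 (maxn (size (y k1)) (size (y k2)))) => n.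
  rewrite !geq_max => /and3P[nn1 nk1 nk2].
  have [k /andP[kn nk]] := loc n.
  have kk1 := loc_ge _ _ _ nk1 nk; have kk2 := loc_ge _ _ _ nk2 nk.
  have := H1 _ kk1; have := H2 _ kk2; have := H2 _ (leqW kk2).
  have -> : mkseq e n = y k ++ take (n - size (y k)) (tail k).
    rewrite (He k.+1) ?(ltnW nk) // yS take_cat ltnNge kn //.
  have fu : f (y k ++ take (n - size (y k)) (tail k)) <= f (y k) + C.
    by rewrite (le_trans (f_cat _ _)) // lerD2l.
  have fl' : f (y k.+1) <= f (y k ++ take (n - size (y k)) (tail k)) + C.
    rewrite yS -{1}(cat_take_drop (n - size (y k)) (tail k)) catA.
    by rewrite (le_trans (f_cat _ _)) // lerD2l.
  have CN : C <= eps / 4 * n%:R.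
    rewrite mulrC -ler_pdivrMr ?(le_trans Hn1) ?ler_nat //; lra.
  have a1 : (size (y k))%:R <= n%:R :> R by rewrite ler_nat.
  have a2 : n%:R <= (size (y k.+1))%:R :> R by rewrite ler_nat ltnW.
  have a3 : (size (y k.+1))%:R = (size (y k))%:R + (size (tail k))%:R :> R.
    by rewrite szS natrD.
  move: fu fl' a1 a2 a3; set F := f (_ ++ _); set s := (size (y k))%:R.
  set s' := (size (y k.+1))%:R; set l := (size (tail k))%:R; set N := n%:R.
  move=> fu fl' a1 a2 a3 b1 b2 b3.
  have s0 : 0 <= s by []. have l0 : 0 <= l by [].
  have tN : `|t * (N - s)| <= `|t| * (e1 * N).
    by rewrite normrM ler_wpM2l // ger0_norm; nra.
  have tN' : `|t * (s' - N)| <= `|t| * (e1 * N).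
    by rewrite normrM ler_wpM2l // ger0_norm; nra.
  have e1N : e1 * (4 * (`|t| + 1)) * N <= eps * N by rewrite ler_wpM2r // (le_trans s0).
  have e1s : e1 * s <= e1 * N by rewrite ler_wpM2l // ltW.
  have e1l : e1 * s' <= 2 * (e1 * N).
    have : s' <= 2 * N by nra.
    by rewrite mulrCA; move=> ?; rewrite ler_wpM2l // ltW.
  move: b1 b2 tN tN'; rewrite !ler_norml => /andP[b1 b1'] /andP[b2 b2'].
  move=> /andP[c1 c1'] /andP[c2 c2'].
  apply/andP; split; nra.
- pose e1 := Num.min 1 (eps / 4).
  have e10 : 0 < e1 by rewrite lt_min ltr01; lra.
  have e11 : e1 <= 1 by rewrite ge_min lexx.
  have e12 : e1 <= eps / 4 by rewrite ge_min lexx orbT.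
  have [k1 H1] := tl _ e10.
  exists (size (y k1.+1)) => n nk1.
  have [k /andP[kn nk]] := loc n.
  have kk1 := loc_ge _ _ _ nk1 nk.
  (* The current tail may be cut before its [o], so [o] is taken from the previous tail, which is
     complete at [n]. Two tail lengths are lost, which [eps / 4] covers. *)
  case: k kn nk kk1 => // k kn nk kk1.
  have oi : (index o (tail k) < size (tail k))%N by rewrite index_mem.
  exists (size (y k) + index o (tail k))%N; split.
  + by rewrite (leq_trans _ kn) // szS ltn_add2l.
  + have := H1 _ kk1; have := H1 _ (leqW kk1).
    have b1 : n%:R <= (size (y k.+2))%:R :> R by rewrite ler_nat ltnW.
    have b2 : (size (y k.+2))%:R = (size (y k.+1))%:R + (size (tail k.+1))%:R :> R.
      by rewrite szS natrD.
    have b3 : (size (y k.+1))%:R = (size (y k))%:R + (size (tail k))%:R :> R.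
      by rewrite szS natrD.
    have b4 : (size (y k))%:R <= (size (y k) + index o (tail k))%:R :> R.
      by rewrite ler_nat leq_addr.
    move: b1 b2 b3 b4; set N := n%:R; set s2 := (size (y k.+2))%:R.
    set s1 := (size (y k.+1))%:R; set s := (size (y k))%:R.
    set l1 := (size (tail k.+1))%:R; set l := (size (tail k))%:R; set p := _%:R.
    move=> b1 b2 b3 b4 c1 c2.
    have s0 : 0 <= s by []. have l0 : 0 <= l by [].
    have [eg|el] := leP 1 eps; first by have : 0 <= N by []; nra.
    have q1 : s1 <= (1 + e1) * s by nra.
    have q2 : N <= (1 + e1) * s1 by nra.
    have q3 : N <= (1 + eps / 4) * ((1 + eps / 4) * s).
      have u1 : s1 <= (1 + eps / 4) * s by nra.
      by nra.
    apply: le_trans b4.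
    have : (1 - eps) * ((1 + eps / 4) * (1 + eps / 4)) <= 1 by nra.
    by nra.
  + have lt : (size (y k) + index o (tail k) < size (y k.+1))%N.
      by rewrite szS ltn_add2l.
    have := He k.+1 _ (leqnn _); rewrite take_size => Hy.
    have := nth_mkseq o e lt; rewrite Hy => <-.
    by rewrite yS nth_cat ltnNge leq_addr /= addKn nth_index.
Qed.

End Words.

Lemma extremal_word (R : realType) (A : finType) (o : A) (f : seq A -> R) n :
  (exists u, size u = n /\ forall v, size v = n -> f u <= f v) /\
  (exists u, size u = n /\ forall v, size v = n -> f v <= f u).
Proof.
split.
- case: (@Order.TotalTheory.arg_minP _ _ _ (nseq_tuple n o) xpredT
    (fun u : n.-tuple A => f u)) => // u _ Hu; exists u; rewrite size_tuple.
  by split=> // v sv; have := Hu (tcast sv (in_tuple v)) isT; rewrite val_tcast.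
- case: (@Order.TotalTheory.arg_maxP _ _ _ (nseq_tuple n o) xpredT
    (fun u : n.-tuple A => f u)) => // u _ Hu; exists u; rewrite size_tuple.
  by split=> // v sv; have := Hu (tcast sv (in_tuple v)) isT; rewrite val_tcast.
Qed.

Section WordSpectrum.
Variables (R : realType) (A : finType) (o : A) (f : seq A -> R) (C Q : R).
Variable L : nat.
Hypothesis f_cat : forall u v, f (u ++ v) <= f u + f v.
Hypothesis f_le : forall u, f u <= C.
Hypothesis f_ge : forall u, - Q * (size u)%:R <= f u.
Hypothesis f_connect : forall u v, exists z,
  [/\ size z = L, o \in z & f u + f v - C <= f (u ++ z ++ v)].

Let C_ge0 : 0 <= C.
Proof. by apply: le_trans (f_le [::]); have := f_ge [::]; rewrite mulr0. Qed.

(** Both extremes are subadditive in the length, for opposite reasons: two minimisers concatenate to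
    a competitor, and a maximiser splits into two competitors. The maxima dominate [E2 * n] at every
    [n], whereas the minima come close to [E1 * n] only asymptotically. *)
Lemma extremal_exponents : exists E1 E2 : R,
  [/\ - Q <= E1, E1 <= E2, E2 <= 0,
    forall u, E1 * (size u)%:R <= f u &
    [/\ forall eps : R, 0 < eps -> exists n0 : nat, forall u, (n0 <= size u)%N ->
        f u <= (E2 + eps) * (size u)%:R,
      forall n, exists u, size u = n /\ E2 * n%:R <= f u &
      exists um : nat -> seq A, (forall n, size (um n) = n) /\
      forall eps : R, 0 < eps -> exists n0 : nat, forall n, (n0 <= n)%N ->
        f (um n) <= (E1 + eps) * n%:R]].
Proof.
have [um Hm] := choice (fun n => (extremal_word o f n).1).
have [ux Hx] := choice (fun n => (extremal_word o f n).2).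
have sm n : size (um n) = n by case: (Hm n).
have sx n : size (ux n) = n by case: (Hx n).
have m_le u : f (um (size u)) <= f u by case: (Hm (size u)) => _ /(_ u erefl).
have x_ge u : f u <= f (ux (size u)) by case: (Hx (size u)) => _ /(_ u erefl).
have [||E1 [E1a E1b]] := @fekete R (fun n => f (um n)) Q.
- move=> m n; apply: le_trans (f_cat (um m) (um n)).
  by have := m_le (um m ++ um n); rewrite size_cat !sm.
- by move=> n; have := f_ge (um n); rewrite sm.
have [||E2 [E2a E2b]] := @fekete R (fun n => f (ux n)) Q.
- move=> m n; rewrite -{1}(cat_take_drop m (ux (m + n)%N)).
  apply: (le_trans (f_cat _ _)); apply: lerD.
    by have := x_ge (take m (ux (m + n)%N)); rewrite size_take_min sx (minn_idPl (leq_addr _ _)).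
  by have := x_ge (drop m (ux (m + n)%N)); rewrite size_drop sx addKn.
- by move=> n; have := f_ge (ux n); rewrite sx.
exists E1, E2; split.
- apply/ler_addgt0Pr => e e0; have [n0 Hn0] := E1b _ e0.
  have := Hn0 n0.+1 (leqnSn _); have := f_ge (um n0.+1); rewrite sm => a b.
  by rewrite -(@ler_pM2r _ n0.+1%:R) ?ltr0n // (le_trans a).
- apply/ler_addgt0Pr => e e0; have [n0 Hn0] := E2b _ e0.
  have := Hn0 n0.+1 (leqnSn _); have := E1a n0.+1; have := m_le (ux n0.+1).
  rewrite sx => a b c.
  by rewrite -(@ler_pM2r _ n0.+1%:R) ?ltr0n // (le_trans b) // (le_trans a).
- apply/ler_addgt0Pr => e e0; rewrite add0r.
  have [n Hn] := archi_ge (C / e).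
  rewrite -(@ler_pM2r _ n.+1%:R) ?ltr0n // (le_trans (E2a _)) // (le_trans (f_le _)) //.
  by rewrite mulrC -ler_pdivrMr // (le_trans Hn) // ler_nat.
- by move=> u; apply: le_trans (m_le u).
split.
- move=> e e0; have [n0 Hn0] := E2b _ e0; exists n0 => u un.
  by rewrite (le_trans (x_ge u)) // Hn0.
- by move=> n; exists (ux n).
- by exists um.
Qed.

(* Greedily append short words of extremal weight, choosing at each step the
   light or the heavy one so as to correct the deviation of [f] from
   [t * size]. *)
Lemma greedy_chain (E1 t : R) (um ux : nat -> seq A) :
  - Q <= E1 -> E1 <= t -> t <= 0 ->
  (forall n, size (um n) = n) -> (forall n, size (ux n) = n) ->
  (forall n, E1 * n%:R <= f (um n)) ->
  (forall n, t * n%:R <= f (ux n)) ->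
  (forall eps : R, 0 < eps -> exists n0 : nat, forall n, (n0 <= n)%N ->
        f (um n) <= (E1 + eps) * n%:R) ->
  exists y tail : nat -> seq A,
  [/\ y 0%N = [::], forall k, y k.+1 = y k ++ tail k,
      forall k, o \in tail k,
      forall eps : R, 0 < eps -> exists k0 : nat, forall k, (k0 <= k)%N ->
        (size (tail k))%:R <= eps * (size (y k))%:R &
      forall eps : R, 0 < eps -> exists k0 : nat, forall k, (k0 <= k)%N ->
        `|f (y k) - t * (size (y k))%:R| <= eps * (size (y k))%:R].
Proof.
move=> QE E1t t0 sm sx m_ge x_ge m_le.
have [z0 Hz0] := choice (fun uv : seq A * seq A => f_connect uv.1 uv.2).
pose z u v := z0 (u, v).
have Hz u v : [/\ size (z u v) = L, o \in z u v &
    f u + f v - C <= f (u ++ z u v ++ v)] by have := Hz0 (u, v).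
pose nxt k y := if t * (size y)%:R < f y then um k else ux k.
(* Stage [k] appends a block of length [k], so the total length is quadratic: the last block and the
   [k] connectors of length [L] are both negligible against it. *)
pose y := nat_rect (fun _ => seq A) [::]
  (fun k y => y ++ (z y (nxt k y) ++ nxt k y)).
pose tail k := z (y k) (nxt k (y k)) ++ nxt k (y k).
have y0 : y 0%N = [::] by [].
have yS k : y k.+1 = y k ++ tail k by [].
have ot k : o \in tail k by rewrite mem_cat; case: (Hz (y k) (nxt k (y k))) => _ ->.
have st k : size (tail k) = (L + k)%N.
  rewrite size_cat; case: (Hz (y k) (nxt k (y k))) => -> _ _.
  by rewrite /nxt; case: ifP; rewrite ?sm ?sx.
have sk := size_chain y0 yS ot.
have sk2 k : (k * (k - 1) <= 2 * size (y k))%N.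
  elim: k => // k IH; rewrite yS size_cat st; nia.
have Q0 : 0 <= Q by lra.
have L0 : 0 <= L%:R :> R by [].
(* [2 * C + Q * L] pays for the cuts and the connector of one step; the further [Q], multiplied by
   [k + 1], pays for a whole block that overshoots the target. *)
pose K := 2 * C + Q * L%:R + Q.
have K0 : 0 <= K by rewrite !addr_ge0 // mulr_ge0.
pose G k := C + \sum_(i < k) (K + (f (um i) - E1 * i%:R)).
have GS k : G k.+1 = G k + (K + (f (um k) - E1 * k%:R)) by rewrite /G big_ord_recr /= addrA.
have GK k : K * k%:R <= G k.
  elim: k => [|k IH]; first by rewrite mulr0 /G big_ord0 addr0.
  by rewrite GS -natr1 mulrDr mulr1; have := m_ge k; lra.
(* The choice in [nxt] pulls the deviation back. Either it keeps its sign and grows by at most the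
   increment of [G], or it crosses zero and is at most [K * (k + 1)], which [GK] bounds. *)
have Dk k : `|f (y k) - t * (size (y k))%:R| <= G k.
  elim: k => [|k].
    rewrite /G big_ord0 mulr0 subr0 addr0 ger0_norm ?f_le //.
    by have := f_ge [::]; rewrite mulr0.
  have := GK k.+1; rewrite GS -natr1.
  have sE : (size (y k.+1))%:R = (size (y k))%:R + L%:R + k%:R :> R.
    by rewrite yS size_cat st !natrD addrA.
  rewrite sE; set s := (size (y k))%:R.
  have [_ _ lo] := Hz (y k) (nxt k (y k)).
  have hi : f (y k.+1) <= f (y k) + C + f (nxt k (y k)).
    rewrite yS (le_trans (f_cat _ _)) // -addrA lerD2l (le_trans (f_cat _ _)) //.
    by rewrite lerD2r.
  rewrite -yS in lo; have s0 : 0 <= s by []. have k0 : 0 <= k%:R :> R by [].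
  have tL : - (Q * L%:R) <= t * L%:R by rewrite -mulNr ler_wpM2r //; lra.
  have tL' : t * L%:R <= 0 by rewrite mulr_le0_ge0.
  have tk : t * k%:R <= 0 by rewrite mulr_le0_ge0.
  have tk' : - (Q * k%:R) <= t * k%:R by rewrite -mulNr ler_wpM2r //; lra.
  have E1k : E1 * k%:R <= t * k%:R by rewrite ler_wpM2r.
  have QL : 0 <= Q * L%:R by rewrite mulr_ge0.
  have Qk : 0 <= Q * k%:R by rewrite mulr_ge0.
  have Ck : 0 <= C * k%:R by rewrite mulr_ge0.
  have QLk : 0 <= Q * L%:R * k%:R by rewrite mulr_ge0.
  have fm := f_ge (um k); rewrite sm in fm.
  have mk := m_ge k; have xk := x_ge k.
  move: hi lo; rewrite /nxt; case: ifP => [Dpos|/negbT Dneg] hi lo; rewrite !ler_norml.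
    by rewrite /K => GKk /andP[b1 b2]; apply/andP; split; nra.
  rewrite -leNgt in Dneg.
  have fx := f_le (ux k).
  by rewrite /K => GKk /andP[b1 b2]; apply/andP; split; nra.
exists y, tail; split=> //.
- move=> eps e0; have [n Hn] := archi_ge (2 * (L%:R + 1) / eps).
  exists n.+2 => k nk; rewrite st natrD.
  have : (k * (k - 1))%:R <= (2 * size (y k))%:R :> R by rewrite ler_nat.
  rewrite !natrM natrB; last by lia.
  have : n%:R + 2 <= k%:R :> R by rewrite -natrD ler_nat addn2.
  move: Hn; rewrite ler_pdivrMr //; set s := (size (y k))%:R; set kk := k%:R.
  move=> h1 h2 h3.
  have n0 : 0 <= n%:R :> R by [].
  have h4 : L%:R + kk <= (L%:R + 1) * kk by nra.
  have h5 : 2 * (L%:R + 1) <= (kk - 1) * eps by nra.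
  have : (L%:R + 1) * 2 * kk <= (kk - 1) * eps * kk by nra.
  have : eps * (kk * (kk - 1)) <= eps * (2 * s) by rewrite ler_pM2l.
  nra.
- move=> eps e0; have e4 : 0 < eps / 4 by lra.
  have [n1 Hn1] := m_le _ e4; have [n2 Hn2] := archi_ge (K / (eps / 4)).
  pose k0 := maxn n1 n2.
  (* From [k0] on, an increment of [G] is at most [eps / 2] times the length of the appended
     block. *)
  have Gk k : (k0 <= k)%N -> G k <= G k0 + eps / 2 * (size (y k))%:R.
    move=> /subnKC <-; elim: (k - k0)%N => [|m IH].
      by rewrite addn0 lerDl mulr_ge0 //; lra.
    rewrite addnS GS; set i := (k0 + m)%N in IH *.
    have i1 : (n1 <= i)%N by rewrite (leq_trans (leq_maxl n1 n2)) // leq_addr.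
    have i2 : n2%:R <= i%:R :> R.
      by rewrite ler_nat (leq_trans (leq_maxr n1 n2)) // leq_addr.
    have h1 := Hn1 _ i1.
    have h2 : K <= eps / 4 * i%:R by rewrite mulrC -ler_pdivrMr // (le_trans Hn2).
    have -> : (size (y i.+1))%:R = (size (y i))%:R + L%:R + i%:R :> R.
      by rewrite yS size_cat st !natrD addrA.
    have : 0 <= eps / 2 * L%:R by rewrite mulr_ge0 //; lra.
    lra.
  have [n3 Hn3] := archi_ge (G k0 / (eps / 2)).
  exists (maxn k0 n3) => k; rewrite geq_max => /andP[kk0 kn3].
  rewrite (le_trans (Dk _)) // (le_trans (Gk _ kk0)) //.
  have : G k0 <= eps / 2 * (size (y k))%:R.
    rewrite mulrC -ler_pdivrMr ?(le_trans Hn3) ?ler_nat ?(leq_trans kn3) //; lra.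
  lra.
Qed.
End WordSpectrum.

(** * Exponents of periodic sequences *)

Section PeriodicWords.
Variables (R : realType) (A : finType) (o : A) (f : seq A -> R) (C Q : R).
Variables (L : nat) (P : seq A -> Prop).
Hypothesis f_cat : forall u v, f (u ++ v) <= f u + f v.
Hypothesis f_le : forall u, f u <= C.
Hypothesis f_ge : forall u, - Q * (size u)%:R <= f u.
Hypothesis f_connect : forall u v, exists z,
  [/\ size z = L, o \in z & f u + f v - C <= f (u ++ z ++ v)].
Hypothesis f_loop : forall y, exists z,
  [/\ size z = L, o \in z, P (z ++ y) &
      forall n, n.+1%:R * (f y - C) <= f (y ++ flatten (nseq n (z ++ y)))].

(** The exponent per period is the Fekete rate of the powers of [w = z ++ y]. It is at most
    [f w <= C + f y]; conversely [f_loop] keeps [n + 1] copies of [f y] at a cost [C] each, and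
    dividing by [n] leaves [f y - C]. The error does not depend on [y]. *)
Lemma periodic_regular y : exists w E e,
  [/\ P w, w != [::], o \in w, forall n, onth w (n %% size w) = Some (e n) &
    [/\ regular f o e E, size w = (size y + L)%N &
      `|E * (size w)%:R - f y| <= C]].
Proof.
have [z [sz oz Pzy lo]] := f_loop y; set w := z ++ y in Pzy lo.
have ow : o \in w by rewrite mem_cat oz.
have w0 : w != [::] by case: (w) ow.
have sw : (0 < size w)%N by case: (w) w0.
pose Y k := flatten (nseq k w).
have YD m n : Y (m + n)%N = Y m ++ Y n by rewrite /Y nseqD flatten_cat.
have YS k : Y k.+1 = Y k ++ w by rewrite -addn1 YD /Y /= cats0.
have Y1 : Y 1%N = w by rewrite /Y /= cats0.
have sY k : size (Y k) = (k * size w)%N.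
  by rewrite /Y; elim: k => //= k IH; rewrite size_cat IH mulSn.
have [||E [E_lo E_hi]] := @fekete R (fun n => f (Y n)) (Q * (size w)%:R).
- by move=> m n; rewrite YD.
- by move=> n; have := f_ge (Y n); rewrite sY natrM !mulNr (mulrC n%:R) mulrA.
have sw0 : 0 < (size w)%:R :> R by rewrite ltr0n.
have sw1 : 1 <= (size w)%:R :> R by rewrite ler1n.
have [||e [He reg]] := @chain_regular R A o f C Q f_cat f_le f_ge Y (fun=> w)
    (E / (size w)%:R) erefl YS (fun=> ow).
- move=> eps e0; have [k0 Hk0] := archi_ge (1 / eps).
  exists k0 => k kk; rewrite sY natrM mulrA ler_peMl // mulrC -ler_pdivrMr //.
  by rewrite (le_trans Hk0) // ler_nat.
- move=> eps e0; have [n0 Hn0] := E_hi _ e0; exists n0 => n nn.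
  have := Hn0 _ nn; have := E_lo n; rewrite sY natrM.
  have -> : E / (size w)%:R * (n%:R * (size w)%:R) = E * n%:R.
    by rewrite [n%:R * _]mulrC mulrA divfK // gt_eqF.
  move=> a b; rewrite ger0_norm ?subr_ge0 //.
  rewrite lerBlDl (le_trans b) // mulrDl lerD2l ler_wpM2l ?(ltW e0) //.
  by rewrite ler_peMr.
exists w, (E / (size w)%:R), e; split=> //.
- have nY k n : (n < size (Y k))%N -> nth o (Y k) n = nth o w (n %% size w).
    elim: k n => // k IH n; rewrite -[k.+1]add1n YD Y1 size_cat nth_cat => nk.
    have [lt|ge] := ltnP n (size w); first by rewrite modn_small.
    rewrite IH; last by rewrite ltn_subLR.
    by rewrite -{2}(subnK ge) modnDr.
  move=> n; rewrite onthE (nth_map o) ?ltn_mod //.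
  congr Some; have nn : (n < size (Y n.+1))%N by rewrite sY; nia.
  rewrite -(nY n.+1) //; have := He n.+1 _ (leqnn _); rewrite take_size => <-.
  by rewrite nth_mkseq.
- split=> //; first by rewrite size_cat sz addnC.
  rewrite divfK ?gt_eqF // ler_norml; apply/andP; split.
    rewrite lerBrDl; apply/ler_addgt0Pr => eps e0.
    have e2 : 0 < eps / 2 by lra.
    have [n0 Hn0] := E_hi _ e2.
    have [n1 Hn1] := archi_ge ((2 * C - f y) / (eps / 2)).
    have := Hn0 _ (leqW (leq_maxl n0 n1)); have := lo (maxn n0 n1).+1; set n := (maxn _ _).+1.
    have := f_cat y (Y n); have := f_le y; rewrite -/(Y n) -natr1.
    have : 2 * C - f y <= eps / 2 * n%:R.
      by rewrite [eps / 2 * _]mulrC -ler_pdivrMr // (le_trans Hn1) // ler_nat leqW // leq_maxr.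
    move=> a1 a2 a3 a4 a5.
    have {}a5 : (n%:R + 1) * (f y - C) <= f y + (E + eps / 2) * n%:R.
      by rewrite (le_trans a4) // (le_trans a3) // lerD2l.
    have n1' : (f y - C - E - eps / 2) * n%:R <= eps / 2 * n%:R by lra.
    move: n1'; rewrite ler_pM2r ?ltr0n //; lra.
  have := E_lo 1%N; rewrite /Y /= cats0 mulr1 => h; have := f_cat z y.
  have := f_le z; rewrite -/w; lra.
Qed.

Theorem word_spectrum : exists E1 E2 : R,
  [/\ E1 <= E2, forall u, E1 * (size u)%:R <= f u,
    forall eps : R, 0 < eps -> exists n0 : nat, forall u, (n0 <= size u)%N ->
      f u <= (E2 + eps) * (size u)%:R,
    forall t, E1 <= t <= E2 -> exists e, regular f o e t &
    forall t, E1 <= t <= E2 -> forall eps : R, 0 < eps -> exists w E e,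
      [/\ P w, w != [::], o \in w, forall n, onth w (n %% size w) = Some (e n) &
        regular f o e E /\ `|E - t| <= eps]].
Proof.
have [E1 [E2 [QE1 E12 E20 E1f [E2f E2x [um [sm E1m]]]]]] :=
  extremal_exponents o f_cat f_le f_ge.
have [ux Hux] := choice E2x.
have um_ge n : E1 * n%:R <= f (um n) by rewrite -{1}(sm n).
have ux_ge t : t <= E2 -> forall n, t * n%:R <= f (ux n).
  by move=> tE n; case: (Hux n) => _; apply: le_trans; rewrite ler_wpM2r.
have chain t (h : E1 <= t <= E2) := greedy_chain f_cat f_le f_ge f_connect
  QE1 (andP h).1 (le_trans (andP h).2 E20) sm (fun n => (Hux n).1) um_ge
  (ux_ge t (andP h).2) E1m.
exists E1, E2; split=> // t tE.
- have [y [tl [y0 yS ot tl_o fy_o]]] := chain t tE.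
  have [e [_ reg]] := chain_regular f_cat f_le f_ge y0 yS ot tl_o fy_o.
  by exists e.
- move=> eps e0; have [y [tl [y0 yS ot tl_o fy_o]]] := chain t tE.
  have e2 : 0 < eps / 2 by lra.
  have [k0 Hk0] := fy_o _ e2.
  (* Closing up costs [C + |t| * L] whatever the prefix, hence less than [eps / 2] times the length
     of a long one. *)
  have [k1 Hk1] := archi_ge ((C + `|t| * L%:R) / (eps / 2)).
  pose k := maxn k0 k1; have := Hk0 k (leq_maxl _ _).
  have [w [E [e [Pw w0 ow we [reg sw Ew]]]]] := periodic_regular (y k).
  move=> yk; exists w, E, e; split=> //; split=> //.
  have sk := size_chain y0 yS ot k.
  have w1 : 0 < (size w)%:R :> R by rewrite ltr0n; case: (w) w0.
  rewrite -(@ler_pM2r _ (size w)%:R) // -[X in _ * X <= _]ger0_norm // -normrM.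
  have -> : (E - t) * (size w)%:R = (E * (size w)%:R - f (y k))
     + (f (y k) - t * (size (y k))%:R) + - (t * L%:R).
    by rewrite [in LHS]mulrBl sw natrD; ring.
  apply: (le_trans (ler_normD _ _)); rewrite normrN normrM [`|L%:R|]ger0_norm //.
  have h : `|E * (size w)%:R - f (y k) + (f (y k) - t * (size (y k))%:R)| <=
      C + eps / 2 * (size (y k))%:R by apply: (le_trans (ler_normD _ _)); exact: lerD.
  have h2 : C + `|t| * L%:R <= eps / 2 * (size (y k))%:R.
    rewrite [eps / 2 * _]mulrC -ler_pdivrMr // (le_trans Hk1) // ler_nat.
    by rewrite (leq_trans _ sk) // leq_maxr.
  have h3 : eps * (size (y k))%:R <= eps * (size w)%:R.
    by rewrite ler_pM2l // ler_nat sw leq_addr.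
  lra.
Qed.
End PeriodicWords.

(** * Products of transition matrices *)

Lemma sumr_gt0_ex (R : realType) (I : finType) (P : pred I) (F : I -> R) :
  0 < \sum_(i | P i) F i -> exists2 i, P i & 0 < F i.
Proof.
move=> s0; have [/existsP[i /andP[Pi Fi]]|/existsPn H] :=
  boolP [exists i, P i && (0 < F i)]; first by exists i.
move: s0; rewrite ltNge sumr_le0 // => i Pi.
by rewrite leNgt; have := H i; rewrite Pi.
Qed.

Lemma min_pos (R : realType) (I : finType) (F : I -> R) :
  exists2 c, 0 < c <= 1 & forall i, 0 < F i -> c <= F i.
Proof.
exists (\big[Num.min/1]_(i | 0 < F i) F i).
  apply/andP; split; last by apply: bigmin_le_id.
  by apply: (big_ind (fun x => 0 < x)) => // x y x0 y0; rewrite lt_min x0.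
by move=> i Fi; apply: bigmin_le_cond.
Qed.

Section TransitionProducts.
Variables (R : realType) (d k : nat) (T : 'I_d -> 'M[R]_k) (q : R).
Hypothesis d_ge3 : (3 <= d)%N.
Hypothesis k_gt0 : (0 < k)%N.
Hypothesis q_gt0 : 0 < q.
Hypothesis T_ge0 : forall l j i, 0 <= T l j i.
Hypothesis T_class : forall (l : 'I_d) (j i : 'I_k),
  T l j i != 0 -> i = j + l %[mod d.-1].
(* No such assumption on rows: in the application a row of [T l] can vanish,
   e.g. for [d = 3] and digits [0, 1, 5]. *)
Hypothesis T_col : forall l i, exists j, q <= T l j i.
Hypothesis T_colsum : forall l i, \sum_j T l j i <= 1.

Definition trans_prod (w : seq 'I_d) : 'M[R]_k := \big[mulmx/1%:M]_(l <- w) T l.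
Definition wt (w : seq 'I_d) : nat := (\sum_(l <- w) l)%N.
(** Block positivity without the permutation: by [trans_prod_class] these are the only entries that
    can be non-zero. *)
Definition class_positive (w : seq 'I_d) : Prop :=
  forall j i : 'I_k, i = j + wt w %[mod d.-1] -> 0 < trans_prod w j i.
Definition mass (w : seq 'I_d) : R := \sum_j \sum_i trans_prod w j i.
Definition row_mass (a : nat) (w : seq 'I_d) : R :=
  \sum_(j < k | j == a %[mod d.-1]) \sum_i trans_prod w j i.

Lemma trans_prod_cons l w : trans_prod (l :: w) = T l *m trans_prod w.
Proof. by rewrite /trans_prod big_cons. Qed.

Lemma trans_prod_cat u v : trans_prod (u ++ v) = trans_prod u *m trans_prod v.
Proof.
elim: u => [|l u IH]; first by rewrite {2}/trans_prod big_nil mul1mx.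
by rewrite cat_cons !trans_prod_cons IH mulmxA.
Qed.

Lemma trans_prod_ge0 w j i : 0 <= trans_prod w j i.
Proof.
elim: w j i => [|l w IH] j i; first by rewrite /trans_prod big_nil mxE.
by rewrite trans_prod_cons mxE sumr_ge0 // => m _; rewrite mulr_ge0.
Qed.
Hint Resolve trans_prod_ge0 : core.

Lemma wt_cat u v : wt (u ++ v) = (wt u + wt v)%N.
Proof. by rewrite /wt big_cat. Qed.

Lemma trans_prod_class w (j i : 'I_k) :
  trans_prod w j i != 0 -> i = j + wt w %[mod d.-1].
Proof.
elim: w j i => [|l w IH] j i.
  rewrite /trans_prod /wt !big_nil mxE addn0.
  by have [-> //|] := eqVneq j i; rewrite eqxx.
rewrite trans_prod_cons mxE => nz.
have : 0 < \sum_m T l j m * trans_prod w m i.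
  by rewrite lt_neqAle eq_sym nz sumr_ge0 // => m _; rewrite mulr_ge0.
move=> /sumr_gt0_ex[m _ Tm]; have Tl : T l j m != 0.
  by apply: contraTneq Tm => ->; rewrite mul0r ltxx.
have /IH -> : trans_prod w m i != 0.
  by apply: contraTneq Tm => ->; rewrite mulr0 ltxx.
rewrite -modnDml (T_class Tl) modnDml /wt big_cons addnA //.
Qed.

Lemma trans_prod_colsum w i : \sum_j trans_prod w j i <= 1.
Proof.
elim: w i => [|l w IH] i.
  rewrite /trans_prod big_nil (bigD1 i) //= mxE eqxx big1 ?addr0 // => j ji.
  by rewrite mxE (negbTE ji).
rewrite trans_prod_cons; under eq_bigr do rewrite mxE.
rewrite exchange_big /= (le_trans _ (IH i)) // ler_sum // => m _.
by rewrite -mulr_suml ler_piMl.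
Qed.

Lemma trans_prod_col w i : q ^+ size w <= \sum_j trans_prod w j i.
Proof.
elim: w i => [|l w IH] i.
  rewrite /trans_prod big_nil (bigD1 i) //= mxE eqxx big1 ?addr0 // => j ji.
  by rewrite mxE (negbTE ji).
rewrite trans_prod_cons; under eq_bigr do rewrite mxE.
rewrite exchange_big /= exprS (le_trans (ler_wpM2l (ltW q_gt0) (IH i))) //.
rewrite mulr_sumr ler_sum // => m _; rewrite -mulr_suml ler_wpM2r //.
have [j qj] := T_col l m; rewrite (le_trans qj) // (bigD1 j) //= lerDl.
by rewrite sumr_ge0.
Qed.

Lemma trans_prod_col_gt0 w i : exists j, 0 < trans_prod w j i.
Proof.
have : 0 < \sum_j trans_prod w j i.
  by rewrite (lt_le_trans _ (trans_prod_col w i)) // exprn_gt0.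
by move=> /sumr_gt0_ex[j _ ?]; exists j.
Qed.

(** Column [i] of [trans_prod v] has a positive entry, in some row [m]; its residue makes [m] one of
    the columns where row [j] of [trans_prod u] is positive. *)
Lemma class_positive_cat u v : class_positive u -> class_positive (u ++ v).
Proof.
move=> up j i ji; rewrite trans_prod_cat mxE.
have [m m0] := trans_prod_col_gt0 v i.
rewrite (bigD1 m) //= ltr_wpDr ?sumr_ge0 // => [n _|]; first by rewrite mulr_ge0.
rewrite mulr_gt0 // up //; apply/eqP; rewrite -(eqn_modDr (wt v)).
by rewrite -(trans_prod_class (lt0r_neq0 m0)) ji wt_cat addnA.
Qed.

Lemma mass_cat u v : mass (u ++ v) <= mass u * mass v.
Proof.
rewrite /mass trans_prod_cat.
have -> : \sum_j \sum_i (trans_prod u *m trans_prod v) j i =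
    \sum_m (\sum_j trans_prod u j m) * (\sum_i trans_prod v m i).
  under eq_bigr => j _ do (under eq_bigr do rewrite mxE; rewrite exchange_big).
  rewrite exchange_big; apply: eq_bigr => m _; rewrite /= mulr_suml.
  by apply: eq_bigr => j _; rewrite mulr_sumr.
rewrite [X in X * _]exchange_big /= mulr_suml ler_sum // => m _.
rewrite ler_wpM2l ?sumr_ge0 // [leRHS](bigD1 m) //= lerDl.
by rewrite sumr_ge0 // => j _; rewrite sumr_ge0.
Qed.

Lemma mass_le w : mass w <= k%:R.
Proof.
rewrite /mass exchange_big /= (le_trans (ler_sum _ (fun i _ => trans_prod_colsum w i))) //.
by rewrite sumr_const card_ord.
Qed.

Lemma mass_ge w : q ^+ size w <= mass w.
Proof.
rewrite /mass exchange_big /= (le_trans (trans_prod_col w (Ordinal k_gt0))) //.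
rewrite [leRHS](bigD1 (Ordinal k_gt0)) //= lerDl.
by rewrite sumr_ge0 // => j _; rewrite sumr_ge0.
Qed.

Lemma mass_gt0 w : 0 < mass w.
Proof. by rewrite (lt_le_trans _ (mass_ge w)) // exprn_gt0. Qed.
Hint Resolve mass_gt0 : core.

Lemma row_mass_ge0 a w : 0 <= row_mass a w.
Proof. by rewrite sumr_ge0 // => j _; rewrite sumr_ge0. Qed.
Hint Resolve row_mass_ge0 : core.

Lemma row_mass_le a w : row_mass a w <= mass w.
Proof.
rewrite /mass (bigID (fun j : 'I_k => j == a %[mod d.-1])) /= lerDl.
by rewrite sumr_ge0 // => j _; rewrite sumr_ge0.
Qed.

Lemma row_mass_mod a b w : a = b %[mod d.-1] -> row_mass a w = row_mass b w.
Proof. by rewrite /row_mass => ->. Qed.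

Lemma d1_gt0 : (0 < d.-1)%N. Proof. by case: (d) d_ge3 => [|[]]. Qed.

Lemma row_mass_best w : exists a, mass w <= d.-1%:R * row_mass a w.
Proof.
case: (@Order.TotalTheory.arg_maxP _ _ _ (Ordinal d1_gt0) xpredT
  (fun a : 'I_d.-1 => row_mass a w)) => // a _ Ha; exists a.
rewrite /mass (partition_big (fun j : 'I_k => Ordinal (ltn_pmod j d1_gt0)) xpredT) //=.
rewrite (@le_trans _ _ (\sum_(b < d.-1) row_mass a w)) //; last first.
  by rewrite sumr_const card_ord mulr_natl.
apply: ler_sum => b _; rewrite (le_trans _ (Ha b isT)) //= /row_mass.
rewrite le_eqVlt; apply/orP; left; apply/eqP; apply: eq_bigl => j.
by rewrite -val_eqE /= [(b %% _)%N]modn_small.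
Qed.

(** Rows of class [a] of [u] have their mass in columns of class [a + wt u], from which [z] leads to
    every row of class [a + wt u + wt z] with weight at least [c]. The result is again a mass of
    rows of class [a], so the estimate can be iterated. *)
Lemma row_mass_connect (c : R) a u z v : 0 <= c ->
  (forall j i : 'I_k, i = j + wt z %[mod d.-1] -> c <= trans_prod z j i) ->
  c * row_mass a u * row_mass (a + wt u + wt z) v <= row_mass a (u ++ z ++ v).
Proof.
move=> c0 cz; rewrite [leRHS]/row_mass !trans_prod_cat.
move Ev : (row_mass (a + wt u + wt z) v) => Rv.
rewrite /row_mass mulr_sumr mulr_suml ler_sum // => j ja.
under [leRHS]eq_bigr do rewrite mxE; rewrite exchange_big /=.
rewrite mulr_sumr mulr_suml ler_sum // => m _.
rewrite -mulr_sumr mulrAC mulrC.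
have [->|nz] := eqVneq (trans_prod u j m) 0; first by rewrite !mul0r.
rewrite ler_wpM2l // -Ev /row_mass mulr_sumr.
under [leRHS]eq_bigr do rewrite mxE; rewrite exchange_big /=.
rewrite [leRHS](bigID (fun j : 'I_k => j == a + wt u + wt z %[mod d.-1])) /=.
rewrite ler_wpDr //.
  by rewrite sumr_ge0 // => i _; rewrite sumr_ge0 // => n _; rewrite mulr_ge0.
apply: ler_sum => i ia; rewrite -mulr_sumr ler_wpM2r ?sumr_ge0 // cz //.
rewrite (eqP ia) -[RHS]modnDml (trans_prod_class nz) modnDml -!addnA.
by rewrite -[RHS]modnDml (eqP ja) modnDml.
Qed.

Section Connectors.
Variable B : seq 'I_d.
Hypothesis B_pos : class_positive B.

Definition digit1 : 'I_d := Ordinal (leq_trans (isT : (1 < 3)%N) d_ge3).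

Lemma connector_exists (r : nat) : exists z,
  [/\ size z = (size B).+2, digit1 \in z, wt z = r %[mod d.-1] & class_positive z].
Proof.
(* [s] solves [wt B + 1 + s = r] mod [d - 1]; being reduced, it is a legal digit, and all connectors
   have the same length. *)
pose s := ((r + (d.-1 - (wt B + 1) %% d.-1)) %% d.-1)%N.
have sd : (s < d)%N.
  by rewrite (leq_trans (ltn_pmod _ d1_gt0)) // leq_pred.
exists (B ++ [:: digit1; Ordinal sd]); split.
- by rewrite size_cat addn2.
- by rewrite mem_cat inE eqxx orbT.
- rewrite wt_cat {2}/wt !big_cons big_nil addn0 /= addnA /s modnDmr -modnDml.
  by rewrite addnCA subnKC ?modnDr // ltnW // ltn_pmod // d1_gt0.
- exact: class_positive_cat.
Qed.

Lemma uniform_connectors : exists2 c, 0 < c <= 1 & forall r : nat, exists z,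
  [/\ size z = (size B).+2, digit1 \in z, wt z = r %[mod d.-1], class_positive z &
    forall j i : 'I_k, i = j + wt z %[mod d.-1] -> c <= trans_prod z j i].
Proof.
have [z Hz] := choice (fun r : 'I_d.-1 => connector_exists r).
have [c c01 Hc] := min_pos
  (fun rji : 'I_d.-1 * 'I_k * 'I_k => trans_prod (z rji.1.1) rji.1.2 rji.2).
exists c => // r; pose r' := Ordinal (ltn_pmod r d1_gt0).
have [sz oz wz pz] := Hz r'; exists (z r'); split=> //.
  by rewrite wz /= modn_mod.
by move=> j i ji; apply: (Hc (r', j, i)); exact: pz.
Qed.

Lemma ln_mass_cat u v : ln (mass (u ++ v)) <= ln (mass u) + ln (mass v).
Proof. by rewrite -lnM ?posrE // ler_ln ?posrE ?mulr_gt0 ?mass_gt0 // mass_cat. Qed.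

Lemma ln_mass_le w : ln (mass w) <= ln k%:R.
Proof. by rewrite ler_ln ?posrE ?ltr0n ?mass_gt0 // mass_le. Qed.

Lemma ln_mass_ge w : - (- ln q) * (size w)%:R <= ln (mass w).
Proof.
rewrite opprK mulr_natr -lnXn // ler_ln ?posrE ?exprn_gt0 ?mass_gt0 //.
exact: mass_ge.
Qed.

Lemma ln_mass_connect : exists C : R,
  [/\ forall w, ln (mass w) <= C,
    forall u v, exists z, [/\ size z = (size B).+2, digit1 \in z &
      ln (mass u) + ln (mass v) - C <= ln (mass (u ++ z ++ v))] &
    forall y, exists z, [/\ size z = (size B).+2, digit1 \in z,
      class_positive (z ++ y) /\ wt (z ++ y) = 0 %[mod d.-1] &
      forall n, n.+1%:R * (ln (mass y) - C) <=
        ln (mass (y ++ flatten (nseq n (z ++ y))))]].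
Proof.
have [c /andP[c0 c1] Hc] := uniform_connectors.
have D0 : 0 < d.-1%:R :> R by rewrite ltr0n d1_gt0.
have D1 : 1 <= d.-1%:R :> R by rewrite ler1n d1_gt0.
(* Passing to the heaviest row classes of [u] and [v] costs a factor [d - 1] each, and the connector
   a factor [c]. The further [k] in [C = ln (k * K)] lets the same constant bound [ln (mass w)], as
   [mass w <= k]. *)
pose K : R := d.-1%:R * d.-1%:R / c.
have DD0 : 0 < d.-1%:R * d.-1%:R :> R by apply: mulr_gt0.
have K0 : 0 < K by apply: divr_gt0.
have kR0 : 0 < k%:R :> R by rewrite ltr0n.
have kK0 : 0 < k%:R * K by apply: mulr_gt0.
have kK : ln k%:R <= ln (k%:R * K) :> R.
  rewrite ler_ln ?posrE // ler_peMr // ler_pdivlMr // mul1r.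
  by rewrite (le_trans c1) // mulr_ege1.
have KC : ln K <= ln (k%:R * K).
  by rewrite ler_ln ?posrE // ler_peMl ?ler1n // ltW.
exists (ln (k%:R * K)); split.
- by move=> w; apply: le_trans kK; exact: ln_mass_le.
- move=> u v; have [a Ha] := row_mass_best u; have [b Hb] := row_mass_best v.
  pose x := (a + wt u)%N.
  (* The residue is [b - x], so [z] leads from the columns of class [x] to the heaviest rows of
     [v]. *)
  have [z [sz oz wz pz cz]] := Hc (b + (d.-1 - x %% d.-1))%N.
  exists z; split=> //; rewrite (le_trans (lerB (lexx _) KC)) //.
  have uv0 : 0 < mass u * mass v by rewrite mulr_gt0.
  rewrite -lnM ?posrE // -ln_div ?posrE // ler_ln ?posrE ?divr_gt0 //.
  apply: le_trans (row_mass_le a _); apply: le_trans (row_mass_connect a u v (ltW c0) cz).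
  rewrite (@row_mass_mod (a + wt u + wt z) b); last first.
    rewrite -/x -[LHS]modnDmr wz modnDmr -modnDml addnCA subnKC ?modnDr //.
    by rewrite ltnW // ltn_pmod // d1_gt0.
  rewrite /K invf_div mulrA ler_pdivrMr //.
  have -> : c * row_mass a u * row_mass b v * (d.-1%:R * d.-1%:R) =
    c * ((d.-1%:R * row_mass a u) * (d.-1%:R * row_mass b v)) by ring.
  by rewrite mulrC ler_pM2l // ler_pM // ltW // mass_gt0.
- move=> y; have [b Hb] := row_mass_best y.
  (* Here [z] cancels the weight of [y]: each period [z ++ y] comes back to the class [b], which
     gives both block diagonality and the induction on [n]. *)
  have [z [sz oz wz pz cz]] := Hc (d.-1 - wt y %% d.-1)%N.
  have wzy : wt y + wt z = 0 %[mod d.-1].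
    rewrite -modnDmr wz modnDmr -modnDml subnKC ?modnn ?mod0n //.
    by rewrite ltnW // ltn_pmod // d1_gt0.
  exists z; split=> //.
    by split; [exact: class_positive_cat | rewrite wt_cat addnC].
  move=> n; rewrite (le_trans (ler_wpM2l _ (lerB (lexx _) KC))) //.
  have yK0 : 0 < mass y / K by apply: divr_gt0.
  rewrite -ln_div ?posrE // mulr_natl -lnXn // ler_ln ?posrE ?exprn_gt0 //.
  apply: le_trans (row_mass_le b _).
  have yK : mass y / K <= c * row_mass b y.
    rewrite /K invf_div mulrA ler_pdivrMr // mulrC -mulrA ler_pM2l //.
    by rewrite (le_trans Hb) // mulrC ler_wpM2l // ler_peMl // ltW.
  elim: n => [|n IH] /=.
    rewrite cats0 expr1 (le_trans yK) // ler_piMl //.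
  rewrite -catA; apply: le_trans (row_mass_connect b y _ (ltW c0) cz).
  rewrite (@row_mass_mod (b + wt y + wt z) b); last by rewrite -addnA -modnDmr wzy mod0n addn0.
  by rewrite exprS ler_pM // ?exprn_ge0 // divr_ge0 ?ltW // mass_gt0.
Qed.

End Connectors.
End TransitionProducts.

(** * Entries of the primitive transition matrices *)

Section TransEntry.
Variables (R : realType) (d k : nat) (Lam : {set 'I_k.+1}) (p : 'I_k.+1 -> R).
Hypothesis d_ge3 : (3 <= d)%N.
Hypothesis p_gt0 : forall j, j \in Lam -> 0 < p j.
Hypothesis p_sum : \sum_(j in Lam) p j = 1.

Definition trans_mx (l : 'I_d) : 'M[R]_k :=
  \matrix_(j, i) trans_entry d Lam p l j i.

Let d1_gt0 : (0 < d.-1)%N. Proof. by case: (d) d_ge3 => [|[]]. Qed.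
Let dE : d = d.-1.+1. Proof. by rewrite prednK // (leq_trans _ d_ge3). Qed.

(** At most one [s] solves the equation, so the choice can be written as a sum, which can be
    exchanged with other sums. *)
Lemma trans_entryE l j i : trans_entry d Lam p l j i =
  \sum_(s in Lam | (s * d.-1 + i == l + j * d)%N) p s.
Proof.
rewrite /trans_entry; case: pickP => [s /andP[sL sE]|none].
  rewrite (bigD1 s) /=; last by rewrite sL.
  rewrite big1 ?addr0 // => s' /andP[/andP[s'L s'E] /negP[]].
  rewrite -val_eqE /= -(@eqn_pmul2r d.-1) // -(eqn_add2r i).
  by rewrite (eqP s'E) (eqP sE).
by rewrite big_pred0 // => s; exact: none.
Qed.

Lemma trans_mx_ge0 l j i : 0 <= trans_mx l j i.
Proof. by rewrite mxE trans_entryE sumr_ge0 // => s /andP[/p_gt0/ltW]. Qed.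

Lemma trans_mx_class (l : 'I_d) (j i : 'I_k) :
  trans_mx l j i != 0 -> i = j + l %[mod d.-1].
Proof.
rewrite mxE /trans_entry; case: pickP => [s /andP[_ /eqP sE] _|_]; last by rewrite eqxx.
apply/esym; rewrite addnC -(modnMDl j) addnC -addnA [X in (l + X)%N]addnC -mulnSr.
by rewrite -dE -sE modnMDl.
Qed.

Hypothesis Lam_col : forall (l : 'I_d) (i : 'I_k), exists2 s, s \in Lam &
  exists j : nat, (s * d.-1 + i = l + j * d)%N.

Lemma trans_mx_col : exists2 q, 0 < q <= 1 &
  forall l i, exists j, q <= trans_mx l j i.
Proof.
have [q q01 Hq] := min_pos (fun s : 'I_k.+1 => p s); exists q => // l i.
have [s sL [j sE]] := Lam_col l i.
(* The row is automatically in range: [j * d <= s * (d - 1) + i <= k * (d - 1) + k - 1 < k * d]. *)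
have jk : (j < k)%N.
  have := ltn_ord i; have := leq_ord s; have := dE; move: sE.
  by move: (nat_of_ord s) (nat_of_ord i) (nat_of_ord l) => a b c; nia.
exists (Ordinal jk); rewrite mxE trans_entryE (bigD1 s) /=; last by rewrite sL sE eqxx.
rewrite (le_trans (Hq s (p_gt0 sL))) // lerDl sumr_ge0 //.
by move=> s' /andP[/andP[/p_gt0/ltW]].
Qed.

(** With [l] and [i] fixed, each digit [s] determines at most one row [j], so a column sum is a
    partial sum of the probabilities. *)
Lemma trans_mx_colsum l i : \sum_j trans_mx l j i <= 1.
Proof.
under eq_bigr do rewrite mxE trans_entryE big_mkcondr.
rewrite exchange_big -p_sum ler_sum // => s sL.
have [[j jE]|none] := pselect (exists j : 'I_k, (s * d.-1 + i == l + j * d)%N).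
  rewrite (bigD1 j) //= jE big1 ?addr0 // => j' j'j; case: ifP => // j'E.
  case/negP: j'j; rewrite -val_eqE /= -(@eqn_pmul2r d) ?(leq_trans _ d_ge3) //.
  by rewrite -(eqn_add2l l) -(eqP j'E).
rewrite big1 ?ltW ?p_gt0 // => j _; case: ifP => // jE; case: none; by exists j.
Qed.
End TransEntry.

(** * The self-similar measure of adic intervals *)

Section SelfSimilarMass.
Variables (R : realType) (d k : nat) (Lam : {set 'I_k.+1}) (p : 'I_k.+1 -> R).
Variable mu : probability (measurableTypeR R) R.
Hypothesis d_ge3 : (3 <= d)%N.
Hypothesis k_gt0 : (0 < k)%N.
Hypothesis Lam0 : ord0 \in Lam.
Hypothesis Lamk : ord_max \in Lam.
Hypothesis p_gt0 : forall j, j \in Lam -> 0 < p j.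
Hypothesis p_sum : \sum_(j in Lam) p j = 1.
Hypothesis mu_ss : self_similar_measure d Lam p mu.

Let T := @trans_mx R d k Lam p.
Let dR_gt0 : 0 < d%:R :> R. Proof. by rewrite ltr0n (leq_trans _ d_ge3). Qed.
Let d1E : d.-1%:R = d%:R - 1 :> R.
Proof. by rewrite -subn1 natrB // (leq_trans _ d_ge3). Qed.

Definition mr (E : set R) : R := fine (mu E).

Lemma mrE (E : set R) : measurable E -> mu E = (mr E)%:E.
Proof. by move=> mE; rewrite /mr fineK // fin_num_measure. Qed.

Lemma mr_ge0 E : 0 <= mr E.
Proof. by rewrite /mr fine_ge0. Qed.

Lemma mr_setT : mr setT = 1.
Proof. by rewrite /mr probability_setT. Qed.

Lemma mr_le (E F : set R) : measurable E -> measurable F -> E `<=` F -> mr E <= mr F.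
Proof.
move=> mE mF EF; rewrite -lee_fin -!mrE //.
by apply: le_measure => //; rewrite inE.
Qed.

Lemma mr_le1 E : measurable E -> mr E <= 1.
Proof. by move=> mE; rewrite -mr_setT mr_le. Qed.

Lemma mr_setU_le (E F : set R) : measurable E -> measurable F ->
  mr (E `|` F) <= mr E + mr F.
Proof.
move=> mE mF; rewrite -lee_fin EFinD -!mrE //; last exact: measurableU.
exact: measureU2.
Qed.

Lemma mr_setU_disj (E F : set R) : measurable E -> measurable F ->
  E `&` F = set0 -> mr (E `|` F) = mr E + mr F.
Proof.
move=> mE mF EF; apply/EFin_inj; rewrite EFinD -!mrE //; last exact: measurableU.
by rewrite measureU.
Qed.

Lemma mr0 : mr set0 = 0.
Proof. by rewrite /mr measure0. Qed.

Lemma mr_bigsetU_le (I : Type) (r : seq I) (F : I -> set R) :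
  (forall i, measurable (F i)) -> mr (\big[setU/set0]_(i <- r) F i) <= \sum_(i <- r) mr (F i).
Proof.
move=> mF; elim: r => [|i r IH]; first by rewrite !big_nil mr0.
rewrite !big_cons (le_trans (mr_setU_le _ _)) ?lerD2l //.
exact: bigsetU_measurable.
Qed.

Lemma mr_self_similar (E : set R) : measurable E ->
  mr E = \sum_(j in Lam) p j * mr (simS d j @^-1` E).
Proof.
move=> mE; apply/EFin_inj; rewrite -mrE // mu_ss // -sumEFin.
apply: eq_bigr => j _; rewrite EFinM mrE //.
have mS : measurable_fun [set: measurableTypeR R]
    ((fun x : R => x * d%:R^-1) \+ cst ((j * d.-1)%:R / d%:R) : R -> R).
  by apply: measurable_funD => //; exact: mulrr_measurable.
by have := mS measurableT E mE; rewrite setTI.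
Qed.

Lemma mr_vanish (F : nat -> set R) : (forall n, measurable (F n)) ->
  (forall m n, (m <= n)%N -> F n `<=` F m) -> \bigcap_n F n = set0 ->
  forall e : R, 0 < e -> exists n, mr (F n) < e.
Proof.
move=> mF Fd F0 e e0.
have : mu \o F @ \oo --> mu (\bigcap_n F n).
  apply: nonincreasing_cvg_mu; rewrite ?F0 //.
    exact: (le_lt_trans (probability_le1 mu (mF 0%N)) (ltry 1)).
  by move=> m n mn; apply/subsetPset; exact: Fd.
rewrite F0 measure0 => /fine_cvgP[_ /cvgrPdist_lt /(_ e e0)][N _ HN].
exists N; have := HN N (leqnn N); rewrite /= sub0r normrN.
exact: le_lt_trans (ler_norm _).
Qed.

(** [H] stands for the mass at distance at least [x] beyond an end of [[0, k]]: self-similarity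
    pushes that mass out by the factor [d] again and again, and it vanishes at infinity. *)
Lemma expanding_tail (H : R -> R) : (forall x, 0 <= H x) ->
  (forall x y, x <= y -> H y <= H x) -> (forall x, 0 < x -> H x <= H (d%:R * x)) ->
  (forall e : R, 0 < e -> exists x, H x < e) -> forall x, 0 < x -> H x = 0.
Proof.
move=> H0 Hd Hexp Hlim x x0; apply/eqP; rewrite eq_le H0 andbT.
apply/ler_addgt0Pr => e e0; rewrite add0r.
have [y /ltW Hy] := Hlim e e0; apply: le_trans Hy.
have HX n : H x <= H (d%:R ^+ n * x).
  elim: n => [|n IH]; first by rewrite mul1r.
  by rewrite (le_trans IH) // exprS -mulrA Hexp // mulr_gt0 // exprn_gt0.
have [n Hn] := archi_ge (y / x); apply: (le_trans (HX n)); apply: Hd.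
rewrite -ler_pdivrMr // (le_trans Hn) // -natrX ler_nat ltnW // ltn_expl //.
exact: leq_trans d_ge3.
Qed.

Let p_lt1 j j' : j \in Lam -> j' \in Lam -> j != j' -> p j < 1.
Proof.
move=> jL j'L jj'; rewrite -p_sum (bigD1 j) //= (bigD1 j') /=; last first.
  by rewrite j'L eq_sym.
rewrite ltrDl ltr_wpDr ?p_gt0 // sumr_ge0 // => i /andP[/andP[/p_gt0/ltW]].
by [].
Qed.

Let ord0_max : ord0 != ord_max :> 'I_k.+1.
Proof. by rewrite -val_eqE /= eq_sym -lt0n. Qed.

Let self_zero c (x : R) : c < 1 -> x = c * x -> x = 0.
Proof.
move=> c1 xE; apply/eqP; have /eqP : (1 - c) * x = 0 by rewrite mulrBl mul1r -xE subrr.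
by rewrite mulf_eq0 subr_eq0 gt_eqF.
Qed.

Lemma mr_ge_k : mr `[k%:R, +oo[ = 0.
Proof.
pose F (y : R) := mr `[y, +oo[.
have FE y : F y = \sum_(s in Lam) p s * F (d%:R * y - (s * d.-1)%:R).
  rewrite /F mr_self_similar //; apply: eq_bigr => s _; congr (_ * mr _).
  apply/seteqP; split => x; rewrite /= !in_itv /= !andbT /simS -mulrDl.
    by rewrite ler_pdivlMr // lerBlDr mulrC.
  by rewrite ler_pdivlMr // lerBlDr mulrC.
have Fd x y : x <= y -> F y <= F x.
  move=> xy; apply: mr_le => // z; rewrite /= !in_itv /= !andbT; exact: le_trans.
have F0 x : 0 < x -> F (k%:R + x) = 0.
  move=> x0; apply: (expanding_tail (H := fun x => F (k%:R + x))) x0 => [z|z y zy|z z0|e e0].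
  - exact: mr_ge0.
  - by rewrite /= Fd // lerD2l.
  - rewrite /= FE -[leRHS]mul1r -[X in _ <= X * _]p_sum mulr_suml ler_sum // => s sL.
    apply: (ler_wpM2l (ltW (p_gt0 sL))); rewrite Fd // mulrDr lerBrDr addrAC lerD2r.
    have : (s * d.-1)%:R <= (k * d.-1)%:R :> R by rewrite ler_nat leq_mul2r leq_ord orbT.
    rewrite !natrM d1E; lra.
  - have [|||n Hn] := @mr_vanish (fun n => `[k%:R + n%:R, +oo[%classic) _ _ _ e e0.
    + by [].
    + move=> m n mn z; rewrite /= !in_itv /= !andbT; apply: le_trans.
      by rewrite lerD2l ler_nat.
    + rewrite -subset0 => z /= Hz; have [n Hn] := archi_ge (z - k%:R + 1).
      have := Hz n I; rewrite /= in_itv /= andbT; lra.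
    + by exists n%:R.
(* The end point needs its own argument: at [y = k] the branch [s = k] fixes [k] and all others land
   strictly beyond it, so [F k = p_k * F k] with [p_k < 1], because [0] is a second digit. *)
apply: (@self_zero (p ord_max)); first by rewrite (p_lt1 Lamk Lam0) // eq_sym.
rewrite -/(F _) {1}FE (bigD1 ord_max) //= big1 ?addr0.
  by congr (_ * F _); rewrite natrM d1E; ring.
move=> s /andP[sL sk]; have {}sk : (s < k)%N.
  by rewrite ltn_neqAle leq_ord andbT -(inj_eq val_inj) in sk *.
rewrite (_ : _ - _ = k%:R + (k%:R - s%:R) * d.-1%:R); last by rewrite natrM d1E; ring.
rewrite F0 ?mulr0 // mulr_gt0 ?subr_gt0 ?ltr_nat // ltr0n.
by case: (d) d_ge3 => [|[]].
Qed.

Lemma mr_lt0 : mr `]-oo, 0[ = 0.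
Proof.
pose F (y : R) := mr `]-oo, y[.
have FE y : F y = \sum_(s in Lam) p s * F (d%:R * y - (s * d.-1)%:R).
  rewrite /F mr_self_similar //; apply: eq_bigr => s _; congr (_ * mr _).
  apply/seteqP; split => x; rewrite /= !in_itv /= /simS -mulrDl.
    by rewrite ltr_pdivrMr // ltrBrDr mulrC.
  by rewrite ltr_pdivrMr // ltrBrDr mulrC.
have Fd x y : x <= y -> F x <= F y.
  move=> xy; apply: mr_le => // z; rewrite /= !in_itv /= => zx; exact: lt_le_trans xy.
have F0 x : 0 < x -> F (- x) = 0.
  move=> x0; apply: (expanding_tail (H := fun x => F (- x))) x0 => [z|z y zy|z z0|e e0].
  - exact: mr_ge0.
  - by rewrite /= Fd // lerN2.
  - rewrite /= FE -[leRHS]mul1r -[X in _ <= X * _]p_sum mulr_suml ler_sum // => s sL.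
    by apply: (ler_wpM2l (ltW (p_gt0 sL))); rewrite Fd // mulrN gerBl.
  - have [|||n Hn] := @mr_vanish (fun n => `]-oo, - n%:R[%classic) _ _ _ e e0.
    + by [].
    + move=> m n mn z; rewrite /= !in_itv /= => h; apply: (lt_le_trans h).
      by rewrite lerN2 ler_nat.
    + rewrite -subset0 => z /= Hz; have [n Hn] := archi_ge (- z).
      have := Hz n I; rewrite /= in_itv /=; lra.
    + by exists n%:R.
apply: (@self_zero (p ord0)); first by rewrite (p_lt1 Lam0 Lamk).
rewrite -/(F _) {1}FE (bigD1 ord0) //= big1 ?addr0.
  by congr (_ * F _); rewrite mulr0 mul0n subr0.
move=> s /andP[sL s0]; rewrite mulr0 sub0r F0 ?mulr0 // ltr0n muln_gt0 lt0n.
by rewrite -(inj_eq val_inj) in s0; rewrite s0 /=; case: (d) d_ge3 => [|[]].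
Qed.

End SelfSimilarMass.

(** * Adic intervals coded by words *)

Section Cylinders.
Variables (R : realType) (d : nat).
Hypothesis d_ge3 : (3 <= d)%N.
Let dR_gt0 : 0 < d%:R :> R. Proof. by rewrite ltr0n (leq_trans _ d_ge3). Qed.
Let dR_neq0 : d%:R != 0 :> R. Proof. by rewrite gt_eqF. Qed.

Definition word_val (u : seq 'I_d) : R := foldr (fun (l : 'I_d) x => (l%:R + x) / d%:R) 0 u.

(** Half-open, so that the translates by distinct integers are disjoint and the adic intervals of
    one level leave no gaps. *)
Definition cyl (u : seq 'I_d) (c : R) : set R :=
  `[c + word_val u, c + word_val u + d%:R^-1 ^+ size u[.

Lemma measurable_cyl u c : measurable (cyl u c : set (measurableTypeR R)).
Proof. exact: measurable_itv. Qed.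

Lemma word_val_ge0 u : 0 <= word_val u.
Proof. by elim: u => //= l u IH; rewrite divr_ge0 ?addr_ge0. Qed.

Lemma word_val_le1 u : word_val u + d%:R^-1 ^+ size u <= 1.
Proof.
elim: u => [|l u IH] /=; first by rewrite add0r.
rewrite exprS [_^-1 * _]mulrC -mulrDl ler_pdivrMr // mul1r -addrA.
have : l%:R + 1 <= d%:R :> R by rewrite natr1 ler_nat.
lra.
Qed.

Lemma word_val_nat u : exists N : nat, word_val u * d%:R ^+ size u = N%:R.
Proof.
elim: u => [|l u [N IH]] /=; first by exists 0%N; rewrite mul0r.
exists (l * d ^ size u + N)%N.
rewrite exprS mulrA divfK // mulrDl IH natrD natrM natrX //.
Qed.

Lemma word_val_rcons u l :
  word_val (rcons u l) = word_val u + l%:R * d%:R^-1 ^+ (size u).+1.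
Proof.
elim: u => [|l' u IH] /=; first by rewrite addr0 add0r.
by rewrite IH addrA mulrDl -mulrA -exprSr.
Qed.

Lemma cyl_sub1 u c : cyl u c `<=` `[c, c + 1[.
Proof.
move=> x; rewrite /cyl /= !in_itv /= => /andP[a b].
by have v0 := word_val_ge0 u; have v1 := word_val_le1 u; apply/andP; split; lra.
Qed.

Lemma digit_exists (x : R) : 0 <= x < 1 -> exists l : 'I_d, 0 <= x * d%:R - l%:R < 1.
Proof.
move=> /andP[x0 x1]; have xd : 0 <= x * d%:R by rewrite mulr_ge0.
have /andP[h1 h2] := truncn_itv xd.
have ld : (Num.truncn (x * d%:R) < d)%N.
  by rewrite -(ltr_nat R) (le_lt_trans h1) // gtr_pMl.
by exists (Ordinal ld); rewrite /= subr_ge0 h1 ltrBlDl natr1.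
Qed.

Lemma word_exists n (x : R) : 0 <= x < 1 -> exists u, size u = n /\ cyl u 0 x.
Proof.
elim: n x => [|n IH] x x01.
  by exists [::]; split=> //; rewrite /cyl /= in_itv /= !add0r expr0.
have [l Hl] := digit_exists x01; have [u [su]] := IH _ Hl.
rewrite /cyl /= in_itv /= !add0r => /andP[a b].
exists (l :: u); rewrite /= su in b *; split=> //.
rewrite in_itv /= !add0r ler_pdivrMr // exprS [_^-1 * _]mulrC -mulrDl ltr_pdivlMr //.
by apply/andP; split; lra.
Qed.

Lemma cyl_of_int n (z : int) : exists u (m : int),
  size u = n /\ m%:~R + word_val u = z%:~R * d%:R^-1 ^+ n.
Proof.
pose x : R := z%:~R * d%:R^-1 ^+ n; pose m := Num.floor x.
have x01 : 0 <= x - m%:~R < 1.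
  by rewrite subr_ge0 floor_le_tmp ltrBlDl -intrD1 floorD1_gt.
have [u [su]] := word_exists n x01; rewrite /cyl /= in_itv /= !add0r su => /andP[a b].
exists u, m; split=> //; have [N HN] := word_val_nat u.
have dn0 : 0 < d%:R ^+ n :> R by rewrite exprn_gt0.
have xE : x * d%:R ^+ n = z%:~R by rewrite /x -mulrA -exprMn mulVf // expr1n mulr1.
rewrite su in HN.
(* [N] and [z - m * d ^ n] are integers less than 1 apart, so the interval found starts at the given
   adic point. *)
have e1 : N%:R <= (z%:~R - m%:~R * d%:R ^+ n : R).
  by rewrite -HN -xE -mulrBl ler_pM2r.
have e2 : (z%:~R - m%:~R * d%:R ^+ n : R) < N%:R + 1.
  have dd : d%:R^-1 ^+ n * d%:R ^+ n = 1 :> R by rewrite -exprMn mulVf // expr1n.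
  by rewrite -HN -xE -mulrBl -[X in _ < _ + X]dd -mulrDl ltr_pM2r.
have zE : (z - m * (d ^ n)%:Z)%:~R = z%:~R - m%:~R * d%:R ^+ n :> R.
  by rewrite intrB intrM -[(d ^ n)%:Z%:~R]/((d ^ n)%:R) natrX.
move: e1 e2; rewrite -zE -[N%:R]/(N%:Z%:~R) -intrD1 ler_int ltr_int => e1 e2.
have NE : N%:Z = z - m * (d ^ n)%:Z by move: e1 e2; set zz := z - _; lia.
have {}HN : word_val u * d%:R ^+ n = z%:~R - m%:~R * d%:R ^+ n.
  by rewrite HN -zE -NE.
apply: (mulIf (lt0r_neq0 dn0)); rewrite mulrDl HN -/x xE; ring.
Qed.
End Cylinders.

Section CylinderMass.
Variables (R : realType) (d k : nat) (Lam : {set 'I_k.+1}) (p : 'I_k.+1 -> R).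
Variable mu : probability (measurableTypeR R) R.
Hypothesis d_ge3 : (3 <= d)%N.
Hypothesis k_gt0 : (0 < k)%N.
Hypothesis Lam0 : ord0 \in Lam.
Hypothesis Lamk : ord_max \in Lam.
Hypothesis p_gt0 : forall j, j \in Lam -> 0 < p j.
Hypothesis p_sum : \sum_(j in Lam) p j = 1.
Hypothesis mu_ss : self_similar_measure d Lam p mu.
Let T := @trans_mx R d k Lam p.
Let dR_gt0 : 0 < d%:R :> R. Proof. by rewrite ltr0n (leq_trans _ d_ge3). Qed.

Lemma simS_cyl (s : 'I_k.+1) (l : 'I_d) u (c : R) :
  simS d s @^-1` cyl (l :: u) c = cyl u (l%:R + c * d%:R - (s * d.-1)%:R).
Proof.
have cE : c = c * d%:R / d%:R by rewrite mulfK // gt_eqF.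
have E x : (simS d s x \in `[c + word_val R (l :: u),
      c + word_val R (l :: u) + d%:R^-1 ^+ size (l :: u)[) =
    (x \in `[l%:R + c * d%:R - (s * d.-1)%:R + word_val R u,
      l%:R + c * d%:R - (s * d.-1)%:R + word_val R u + d%:R^-1 ^+ size u[).
  rewrite !in_itv /= /simS {1 2}cE exprS [_^-1 * _]mulrC -!mulrDl.
  rewrite ler_pM2r ?invr_gt0 // ltr_pM2r ?invr_gt0 //.
  by congr (_ && _); apply/idP/idP; lra.
by apply/seteqP; split=> x; rewrite /cyl /= E.
Qed.

Lemma mr_cyl_out (u : seq 'I_d) (c : R) : c + 1 <= 0 \/ k%:R <= c -> mr mu (cyl u c) = 0.
Proof.
move=> h; apply/eqP; rewrite eq_le mr_ge0 andbT.
case: h => h.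
  rewrite -(mr_lt0 d_ge3 k_gt0 Lam0 Lamk p_gt0 p_sum mu_ss).
  apply: mr_le => [||x /cyl_sub1]; rewrite ?/= ?in_itv //=; first exact: measurable_cyl.
  by move=> /(_ d_ge3) /andP[_ xc]; rewrite (lt_le_trans xc).
rewrite -(mr_ge_k d_ge3 k_gt0 Lam0 Lamk p_gt0 p_sum mu_ss).
apply: mr_le => [||x /cyl_sub1]; rewrite ?/= ?in_itv //=; first exact: measurable_cyl.
by move=> /(_ d_ge3) /andP[cx _]; rewrite andbT (le_trans h).
Qed.

(** The transition matrices are refinement matrices: the preimage under [S_s] of the interval
    [l :: u] at [j] is the interval [u] at [l + j d - s (d - 1)], and this integer is [i] exactly
    when [s] gives the entry at [(j, i)]. *)
Lemma mr_cyl (u : seq 'I_d) (j : 'I_k) :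
  mr mu (cyl u j%:R) = \sum_i trans_prod T u j i * mr mu (cyl ([::] : seq 'I_d) i%:R).
Proof.
elim: u j => [|l u IH] j.
  rewrite /trans_prod big_nil (bigD1 j) //= mxE eqxx mul1r big1 ?addr0 // => i ij.
  by rewrite mxE eq_sym (negbTE ij) mul0r.
rewrite trans_prod_cons; under [RHS]eq_bigr do rewrite mxE mulr_suml.
rewrite exchange_big /=.
under [RHS]eq_bigr => m _.
  under eq_bigr do rewrite -mulrA.
  rewrite -mulr_sumr -IH mxE trans_entryE // big_mkcondr mulr_suml.
  over.
rewrite [RHS]exchange_big /=.
have -> := mr_self_similar mu_ss (measurable_cyl (l :: u) j%:R).
apply: eq_bigr => s _; rewrite simS_cyl.
have [[i iE]|none] := pselect (exists i : 'I_k, (s * d.-1 + i == l + j * d)%N).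
  rewrite (bigD1 i) //= iE big1 ?addr0 => [|i' i'i].
    congr (_ * mr mu _); congr cyl; rewrite -natrM -natrD -(eqP iE) natrD; ring.
  case: ifP => [i'E|]; last by rewrite mul0r.
  by case/negP: i'i; rewrite -val_eqE /= -(eqn_add2l (s * d.-1)) (eqP i'E) (eqP iE).
rewrite big1 => [|i _]; last by case: ifP => [iE|]; [case: none; exists i | rewrite mul0r].
rewrite mr_cyl_out ?mulr0 //.
(* The integer translate is outside [0, ..., k - 1], hence at most -1 or at least [k], where [mu]
   has no mass. *)
have [lt|ge] := ltnP (l + j * d) (s * d.-1).
  left; rewrite -natrM -natrD; have : (l + j * d + 1)%:R <= (s * d.-1)%:R :> R.
    by rewrite ler_nat addn1.
  rewrite [(_ + 1)%:R]natrD; lra.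
right; rewrite -natrM -natrD -natrB // ler_nat leqNgt; apply/negP => lt.
by apply: none; exists (Ordinal lt); rewrite /= subnKC.
Qed.
End CylinderMass.

(** * The quotient measure of adic intervals *)

Section QuotientMass.
Variables (R : realType) (d k : nat) (Lam : {set 'I_k.+1}) (p : 'I_k.+1 -> R).
Variable mu : probability (measurableTypeR R) R.
Hypothesis d_ge3 : (3 <= d)%N.
Hypothesis k_gt0 : (0 < k)%N.
Hypothesis Lam0 : ord0 \in Lam.
Hypothesis Lamk : ord_max \in Lam.
Hypothesis p_gt0 : forall j, j \in Lam -> 0 < p j.
Hypothesis p_sum : \sum_(j in Lam) p j = 1.
Hypothesis mu_ss : self_similar_measure d Lam p mu.
Let T := @trans_mx R d k Lam p.

(** The quotient measure of the adic interval of [u]: as [mu] lives on [[0, k)], only these [k]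
    lifts can carry mass. *)
Definition cyl_mass (u : seq 'I_d) : R := \sum_(j < k) mr mu (cyl u j%:R).

Lemma mr_le_cyl_mass (E : set R) (us : seq (seq 'I_d)) :
  measurable (E : set (measurableTypeR R)) ->
  (forall x, 0 <= x < k%:R -> E x ->
     exists2 u, u \in us & exists j : 'I_k, cyl u j%:R x) ->
  mr mu E <= \sum_(u <- us) cyl_mass u.
Proof.
move=> mE cov.
pose U (u : seq 'I_d) : set R := \big[setU/set0]_(j < k) cyl u j%:R.
have mU u : measurable (U u : set (measurableTypeR R)).
  by apply: bigsetU_measurable => j _; exact: measurable_cyl.
pose W : set R := \big[setU/set0]_(u <- us) U u.
have mW : measurable (W : set (measurableTypeR R)) by exact: bigsetU_measurable.
pose N : set R := `]-oo, 0[%classic `|` `[k%:R, +oo[%classic.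
have mN : measurable (N : set (measurableTypeR R)) by exact: measurableU.
have N0 : mr mu N = 0.
  apply/eqP; rewrite eq_le mr_ge0 andbT (le_trans (mr_setU_le _ _ _)) //.
  rewrite (mr_lt0 d_ge3 k_gt0 Lam0 Lamk p_gt0 p_sum mu_ss).
  by rewrite (mr_ge_k d_ge3 k_gt0 Lam0 Lamk p_gt0 p_sum mu_ss) addr0.
have EW : E `<=` W `|` N.
  move=> x Ex; have [x0|x0] := ltP x 0; first by right; left; rewrite /= in_itv.
  have [xk|xk] := ltP x k%:R; last by right; right; rewrite /= in_itv /= xk.
  have [|u uu [j xj]] := cov x _ Ex; first by rewrite x0.
  left; rewrite /W -bigcup_seq; exists u => //.
  by rewrite /U -(bigcup_mkord k (fun j => cyl u j%:R)); exists j => /=.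
have mWN : measurable (W `|` N : set (measurableTypeR R)) by exact: measurableU.
rewrite (le_trans (mr_le mu mE mWN EW)) //
  (le_trans (mr_setU_le _ mW mN)) // N0 addr0.
rewrite (le_trans (mr_bigsetU_le _ _ mU)) // ler_sum // => u _.
by apply: mr_bigsetU_le => j; exact: measurable_cyl.
Qed.

Lemma cyl_mass_le_mr (E : set R) u : measurable (E : set (measurableTypeR R)) ->
  (forall j : 'I_k, cyl u j%:R `<=` E) -> cyl_mass u <= mr mu E.
Proof.
move=> mE sub.
pose U n : set R := \big[setU/set0]_(j < n) cyl u j%:R.
have mU n : measurable (U n : set (measurableTypeR R)).
  by apply: bigsetU_measurable => j _; exact: measurable_cyl.
have UE n : mr mu (U n) = \sum_(j < n) mr mu (cyl u j%:R).
  elim: n => [|n IH]; first by rewrite /U !big_ord0 mr0.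
  rewrite /U !big_ord_recr /= -/(U n) mr_setU_disj ?IH //; [exact: mU|exact: measurable_cyl|].
  rewrite -subset0 => x [].
  rewrite /U -(bigcup_mkord n (fun j => cyl u j%:R)) => -[j /= jn].
  move=> /(cyl_sub1 d_ge3); rewrite /= in_itv /= => /andP[_ xj].
  move=> /(cyl_sub1 d_ge3); rewrite /= in_itv /= => /andP[nx _].
  have : j%:R + 1 <= n%:R :> R by rewrite natr1 ler_nat.
  lra.
rewrite /cyl_mass -UE; apply: (mr_le mu (mU k) mE) => x.
by rewrite /U -(bigcup_mkord k (fun j => cyl u j%:R)) => -[j /= jk]; apply: (sub (Ordinal jk)).
Qed.

Let v (i : 'I_k) : R := mr mu (cyl ([::] : seq 'I_d) i%:R).

Lemma base_sum_ge1 : 1 <= \sum_i v i.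
Proof.
rewrite -(mr_setT mu) (le_trans (@mr_le_cyl_mass setT [:: [::]] _ _)) //.
  move=> x /andP[x0 xk] _; exists [::]; first by rewrite inE.
  have /andP[h1 h2] := truncn_itv x0.
  have tk : (Num.truncn x < k)%N by rewrite -(ltr_nat R) (le_lt_trans h1).
  by exists (Ordinal tk); rewrite /cyl /= in_itv /= addr0 expr0 h1 natr1.
by rewrite big_seq1.
Qed.

Hypothesis Lam_col : forall (l : 'I_d) (i : 'I_k), exists2 s, s \in Lam &
  exists j : nat, (s * d.-1 + i = l + j * d)%N.
Variable B : seq 'I_d.
Hypothesis B_pos : class_positive T B.

(** Some unit interval [i0] has positive mass, and a connector of the right residue carries a share
    of it into a subinterval of [[j, j + 1)]. *)
Lemma base_gt0 j : 0 < v j.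
Proof.
have [q /andP[q0 _] Tq] := trans_mx_col d_ge3 p_gt0 Lam_col.
have [i0 _ vi0] : exists2 i, true & 0 < v i.
  by apply: sumr_gt0_ex; apply: lt_le_trans base_sum_ge1.
have d10 : (0 < d.-1)%N by case: (d) d_ge3 => [|[]].
have [z [_ _ wz pz]] := connector_exists d_ge3 q0 (trans_mx_ge0 d_ge3 p_gt0)
  (trans_mx_class d_ge3) Tq B_pos (i0 + (d.-1 - j %% d.-1)).
have ji : i0 = j + wt z %[mod d.-1].
  rewrite -modnDmr wz modnDmr -modnDml addnCA subnKC ?modnDr //.
  by rewrite ltnW // ltn_pmod.
apply: (@lt_le_trans _ _ (mr mu (cyl z j%:R))); last first.
  apply: mr_le => [||x]; [exact: measurable_cyl|exact: measurable_cyl|].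
  move=> /(cyl_sub1 d_ge3); rewrite /cyl /= !in_itv /= addr0 expr0.
  by [].
rewrite (mr_cyl d_ge3 k_gt0 Lam0 Lamk p_gt0 p_sum mu_ss) (bigD1 i0) //=.
rewrite ltr_wpDr ?mulr_gt0 ?(pz _ _ ji) // sumr_ge0 // => i _.
rewrite mulr_ge0 ?mr_ge0 // trans_prod_ge0 //.
exact: trans_mx_ge0.
Qed.

Lemma cyl_mass_bounds : exists2 c, 0 < c <= 1 &
  forall u, c * mass T u <= cyl_mass u <= mass T u.
Proof.
have [c c01 Hc] := min_pos v; exists c => // u.
have T0 := trans_mx_ge0 d_ge3 p_gt0.
have -> : cyl_mass u = \sum_j \sum_i trans_prod T u j i * v i.
  by apply: eq_bigr => j _; rewrite (mr_cyl d_ge3 k_gt0 Lam0 Lamk p_gt0 p_sum mu_ss).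
apply/andP; split.
  rewrite /mass mulr_sumr ler_sum // => j _; rewrite mulr_sumr ler_sum // => i _.
  by rewrite mulrC ler_wpM2l ?trans_prod_ge0 // Hc // base_gt0.
rewrite /mass ler_sum // => j _; rewrite ler_sum // => i _.
rewrite ler_piMr ?trans_prod_ge0 // mr_le1 //; exact: measurable_cyl.
Qed.
End QuotientMass.

(** * Balls of the circle *)

Section CircleBalls.
Variable R : realType.

Lemma circle_projP (a b : R) : circle_proj a = circle_proj b <-> a - b \is a Num.int.
Proof.
by split=> [/eqmodP|h]; [|apply/eqmodP].
Qed.

Lemma circle_proj_surj (x : circle R) : exists t : R, x = circle_proj t.
Proof. by exists (repr x); rewrite /circle_proj reprK. Qed.

Lemma circle_ball_preim (t r : R) :
  @circle_proj R @^-1` circle_ball (circle_proj t) r =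
  \bigcup_(m in [set: int]) [set x | `|x - t - m%:~R| < r].
Proof.
apply/seteqP; split=> s.
- rewrite /= /circle_ball /= /circle_dist => /inf_lt[].
    by exists `|t - s|; exists t => //; exists s.
  move=> _ [a /circle_projP /intrP[m1 E1] [b /circle_projP /intrP[m2 E2] <-]] abr.
  exists (m1 - m2) => //=; rewrite intrB -E1 -E2.
  by rewrite (_ : _ - _ - _ = - (a - b)) ?normrN //; ring.
- move=> [m _ /= h]; rewrite /circle_ball /= /circle_dist.
  apply: le_lt_trans h; apply: ge_inf; first by exists 0 => _ [a _ [b _ <-]]; exact: normr_ge0.
  exists (t + m%:~R).
    by apply/circle_projP; rewrite addrAC subrr add0r intr_int.
  by exists s => //; rewrite distrC opprD addrA.
Qed.
End CircleBalls.

(** * Points given by digit sequences *)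

Section DigitPoints.
Variables (R : realType) (d : nat).
Hypothesis d_ge3 : (3 <= d)%N.
Let dR_gt0 : 0 < d%:R :> R. Proof. by rewrite ltr0n (leq_trans _ d_ge3). Qed.
Let dR_ge3 : 3 <= d%:R :> R. Proof. by rewrite ler_nat. Qed.

Definition digit_val (e : nat -> 'I_d) : R :=
  limn (series (fun n => (e n)%:R / d%:R ^+ n.+1 : R)).

Lemma series_word_val (e : nat -> 'I_d) n :
  series (fun n => (e n)%:R / d%:R ^+ n.+1 : R) n = word_val R (mkseq e n).
Proof.
elim: n => [|n IH]; first by rewrite seriesEnat /= big_geq.
by rewrite mkseqS word_val_rcons size_mkseq -IH !seriesEnat /= big_nat_recr //= exprVn.
Qed.

(** Left ends of the successive adic intervals increase and right ends decrease. The right end is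
    included: it is the value when all later digits are [d - 1]. *)
Lemma digit_val_itv (e : nat -> 'I_d) n :
  word_val R (mkseq e n) <= digit_val e <=
  word_val R (mkseq e n) + d%:R^-1 ^+ n.
Proof.
pose s := series (fun n => (e n)%:R / d%:R ^+ n.+1 : R).
have sE m : s m = word_val R (mkseq e m) by exact: series_word_val.
have ndS m : s m <= s m.+1.
  rewrite !sE mkseqS word_val_rcons lerDl mulr_ge0 // exprn_ge0 // invr_ge0 ltW //.
have nds : nondecreasing_seq s by apply/nondecreasing_seqP.
have niS m : s m.+1 + d%:R^-1 ^+ m.+1 <= s m + d%:R^-1 ^+ m.
  rewrite !sE mkseqS word_val_rcons size_mkseq -addrA lerD2l.
  have -> : d%:R^-1 ^+ m = d%:R * d%:R^-1 ^+ m.+1 :> R.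
    by rewrite exprS mulrA divff ?mul1r // gt_eqF.
  have h0 : 0 <= d%:R^-1 ^+ m.+1 :> R by rewrite exprn_ge0 // invr_ge0 ltW.
  have h1 : (e m)%:R + 1 <= d%:R :> R by rewrite natr1 ler_nat.
  by rewrite -[X in _ + X]mul1r -mulrDl ler_wpM2r.
have ni m j : s (m + j)%N + d%:R^-1 ^+ (m + j) <= s m + d%:R^-1 ^+ m.
  by elim: j => [|j IH]; rewrite ?addn0 // addnS (le_trans (niS _)).
have ub m : s m <= s n + d%:R^-1 ^+ n.
  have [nm|mn] := leqP n m.
    rewrite -(subnKC nm) (le_trans _ (ni n (m - n)%N)) // lerDl.
    by rewrite exprn_ge0 // invr_ge0 ltW.
  rewrite (le_trans (nds _ _ (ltnW mn))) // lerDl.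
  by rewrite exprn_ge0 // invr_ge0 ltW.
have cvs : cvgn s.
  apply: nondecreasing_is_cvgn => //; exists (s n + d%:R^-1 ^+ n) => _ [m _ <-].
  exact: ub.
rewrite -sE; apply/andP; split; first exact: nondecreasing_cvgn_le.
by apply: limr_le => //; apply: nearW.
Qed.
End DigitPoints.

Section BallMass.
Variables (R : realType) (d k : nat) (Lam : {set 'I_k.+1}) (p : 'I_k.+1 -> R).
Variable mu : probability (measurableTypeR R) R.
Hypothesis d_ge3 : (3 <= d)%N.
Hypothesis k_gt0 : (0 < k)%N.
Hypothesis Lam0 : ord0 \in Lam.
Hypothesis Lamk : ord_max \in Lam.
Hypothesis p_gt0 : forall j, j \in Lam -> 0 < p j.
Hypothesis p_sum : \sum_(j in Lam) p j = 1.
Hypothesis mu_ss : self_similar_measure d Lam p mu.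
Let dR_gt0 : 0 < d%:R :> R. Proof. by rewrite ltr0n (leq_trans _ d_ge3). Qed.
Let dR_ge3 : 3 <= d%:R :> R. Proof. by rewrite ler_nat. Qed.
Let dn_gt0 n : 0 < d%:R^-1 ^+ n :> R.
Proof. by rewrite exprn_gt0 // invr_gt0. Qed.

Definition ball_mass (x : circle R) (r : R) : R :=
  mr mu (@circle_proj R @^-1` circle_ball x r).

Lemma measurable_circle_ball (x : circle R) (r : R) :
  measurable (@circle_proj R @^-1` circle_ball x r : set (measurableTypeR R)).
Proof.
have [t ->] := circle_proj_surj x; rewrite circle_ball_preim.
apply: open_measurable; apply: bigcup_open => m _.
rewrite (_ : mkset _ = `]t + m%:~R - r, t + m%:~R + r[%classic).
  exact: interval_open.
by apply/seteqP; split=> y; rewrite /= in_itv /= ltr_norml => /andP[? ?];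
  apply/andP; split; lra.
Qed.

Lemma quotient_measure_ball (x : circle R) (r : R) :
  quotient_measure mu (circle_ball x r) = (ball_mass x r)%:E.
Proof. by rewrite /quotient_measure mrE //; exact: measurable_circle_ball. Qed.

Lemma ball_mass_mono x r r' : r <= r' -> ball_mass x r <= ball_mass x r'.
Proof.
move=> rr'; apply: mr_le; [exact: measurable_circle_ball|exact: measurable_circle_ball|].
by move=> y; rewrite /circle_ball /= => /lt_le_trans; apply.
Qed.

(** The point may be the right end, outside the half-open interval; this is harmless because the
    radius strictly exceeds the length. *)
Lemma ball_mass_ge (t r : R) (u : seq 'I_d) (m : int) :
  m%:~R + word_val R u <= t <= m%:~R + word_val R u + d%:R^-1 ^+ size u ->
  d%:R^-1 ^+ size u < r -> cyl_mass k mu u <= ball_mass (circle_proj t) r.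
Proof.
move=> /andP[t1 t2] ur; apply: cyl_mass_le_mr => //.
  exact: measurable_circle_ball.
move=> j s; rewrite circle_ball_preim /cyl /= in_itv /= => /andP[s1 s2].
exists (j%:Z - m) => //=; rewrite intrB -[j%:Z%:~R]/(j%:R) ltr_norml.
by apply/andP; split; lra.
Qed.

Lemma cyl_int_nat (u : seq 'I_d) (c : int) (x : R) : 0 <= x < k%:R ->
  cyl u c%:~R x -> exists j : 'I_k, cyl u j%:R x.
Proof.
move=> /andP[x0 xk] ux; have := cyl_sub1 d_ge3 ux; rewrite /= in_itv /= => /andP[a b].
have c0 : (0 <= c)%R.
  have : (0 : R) < (c + 1)%:~R by rewrite intrD (le_lt_trans x0).
  by rewrite ltr0z; lia.
have ck : (`|c| < k)%N.
  have := le_lt_trans a xk; rewrite -[k%:R]/(k%:Z%:~R) ltr_int; lia.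
exists (Ordinal ck); rewrite /= -[`|c|%:R]/(`|c|%:Z%:~R) gez0_abs //.
Qed.

Lemma ball_mass_le_cyl (t delta : R) (u : seq 'I_d) :
  word_val R u + delta <= t -> t + delta <= word_val R u + d%:R^-1 ^+ size u ->
  ball_mass (circle_proj t) delta <= cyl_mass k mu u.
Proof.
move=> t1 t2; have <- : \sum_(w <- [:: u]) cyl_mass k mu w = cyl_mass k mu u by rewrite big_seq1.
apply: (mr_le_cyl_mass d_ge3 k_gt0 Lam0 Lamk p_gt0 p_sum mu_ss).
  exact: measurable_circle_ball.
move=> x x0k; rewrite circle_ball_preim => -[m _ /=].
rewrite ltr_norml => /andP[a b]; exists u; rewrite ?mem_head //.
apply: (@cyl_int_nat u m) => //; rewrite /cyl /= in_itv /=.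
by apply/andP; split; lra.
Qed.

Lemma ball_mass_le3 (x : circle R) n (M : R) :
  (forall u : seq 'I_d, size u = n -> cyl_mass k mu u <= M) ->
  ball_mass x (d%:R^-1 ^+ n) <= 3 * M.
Proof.
move=> HM; have [t ->] := circle_proj_surj x.
(* An open ball of radius [d^-n] around a point of the [z]-th interval meets only that interval and
   its two neighbours, possibly after wrapping around by an integer. *)
pose z := Num.floor (t * d%:R ^+ n).
have [u0 [m0 [s0 E0]]] := cyl_of_int R d_ge3 n (z - 1).
have [u1 [m1 [s1 E1]]] := cyl_of_int R d_ge3 n z.
have [u2 [m2 [s2 E2]]] := cyl_of_int R d_ge3 n (z + 1).
apply: (@le_trans _ _ (\sum_(u <- [:: u0; u1; u2]) cyl_mass k mu u)); last first.
  rewrite !big_cons big_nil; have := HM _ s0; have := HM _ s1; have := HM _ s2; lra.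
apply: (mr_le_cyl_mass d_ge3 k_gt0 Lam0 Lamk p_gt0 p_sum mu_ss).
  exact: measurable_circle_ball.
move=> y y0k; rewrite circle_ball_preim => -[m _ /=].
rewrite ltr_norml => /andP[a b].
have dd : d%:R^-1 ^+ n * d%:R ^+ n = 1 :> R.
  by rewrite -exprMn mulVf ?expr1n // gt_eqF.
have tz : z%:~R * d%:R^-1 ^+ n <= t < (z%:~R + 1) * d%:R^-1 ^+ n.
  have -> : t = t * d%:R ^+ n * d%:R^-1 ^+ n by rewrite -mulrA [_ * _^-1 ^+ n]mulrC dd mulr1.
  rewrite ler_pM2r // ltr_pM2r //; rewrite floor_le_tmp -intrD1; exact: floorD1_gt.
move: tz a b E0 E1 E2; rewrite !intrD intrN !mulrDl mulN1r mul1r => /andP[tz1 tz2] a b E0 E1 E2.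
have [c1|c1] := ltP (y - m%:~R) (z%:~R * d%:R^-1 ^+ n).
  exists u0; first by rewrite inE eqxx.
  apply: (@cyl_int_nat u0 (m + m0)) => //; rewrite /cyl /= in_itv /= intrD s0.
  by apply/andP; split; lra.
have [c2|c2] := ltP (y - m%:~R) (z%:~R * d%:R^-1 ^+ n + d%:R^-1 ^+ n).
  exists u1; first by rewrite !inE eqxx orbT.
  apply: (@cyl_int_nat u1 (m + m1)) => //; rewrite /cyl /= in_itv /= intrD s1.
  by apply/andP; split; lra.
exists u2; first by rewrite !inE eqxx !orbT.
apply: (@cyl_int_nat u2 (m + m2)) => //; rewrite /cyl /= in_itv /= intrD s2.
by apply/andP; split; lra.
Qed.

Lemma ball_mass_ge_min (x : circle R) n (M r : R) :
  (forall u : seq 'I_d, size u = n -> M <= cyl_mass k mu u) ->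
  d%:R^-1 ^+ n < r -> M <= ball_mass x r.
Proof.
move=> HM nr; have [t ->] := circle_proj_surj x.
have t01 : 0 <= t - (Num.floor t)%:~R < 1.
  by rewrite subr_ge0 floor_le_tmp ltrBlDl -intrD1 floorD1_gt.
have [u [su]] := word_exists d_ge3 n t01.
rewrite /cyl /= in_itv /= !add0r su => /andP[a b].
apply: le_trans (HM u su) _; apply: (@ball_mass_ge _ _ _ (Num.floor t)); last by rewrite su.
by rewrite su; apply/andP; split; lra.
Qed.

Lemma digit_ball_ge (e : nat -> 'I_d) n (r : R) : d%:R^-1 ^+ n < r ->
  cyl_mass k mu (mkseq e n) <= ball_mass (digit_point R e) r.
Proof.
move=> nr; apply: (@ball_mass_ge _ _ _ 0); last by rewrite size_mkseq.
by rewrite add0r size_mkseq; exact: digit_val_itv.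
Qed.

(* The digit 1 lies strictly between 0 and [d - 1], so it keeps the point away
   from both ends of its adic interval. *)
Lemma digit_ball_le (e : nat -> 'I_d) n : e n = digit1 d_ge3 ->
  ball_mass (digit_point R e) (d%:R^-1 ^+ n.+1) <= cyl_mass k mu (mkseq e n).
Proof.
move=> en; have := digit_val_itv R d_ge3 e n.+1.
rewrite mkseqS word_val_rcons size_mkseq en /= mul1r => /andP[a b].
have dn : d%:R^-1 ^+ n = d%:R * d%:R^-1 ^+ n.+1 :> R.
  by rewrite exprS mulrA divff ?mul1r // gt_eqF.
have d3 : 3 * d%:R^-1 ^+ n.+1 <= d%:R * d%:R^-1 ^+ n.+1 :> R.
  by rewrite ler_pM2r.
by apply: (@ball_mass_le_cyl (digit_val R e)); rewrite ?size_mkseq ?dn; lra.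
Qed.
End BallMass.

(** * Local dimensions *)

Section ExtendedLimits.
Variables (R : realType) (T : choiceType) (X : filteredType T).
Variables (F : set_system X) (h : X -> \bar R).
Context {FF : ProperFilter F}.

Lemma limf_einf_ge (l : R) :
  (forall eps : R, 0 < eps -> \forall r \near F, ((l - eps)%:E <= h r)%E) ->
  (l%:E <= limf_einf h F)%E.
Proof.
move=> H; apply/lee_subgt0Pr => e e0; rewrite -EFinB limf_einfE.
pose V := [set r | ((l - e)%:E <= h r)%E].
apply: le_ereal_sup_tmp; exists (ereal_inf (h @` V)); first by exists V => //; exact: H.
by apply: le_ereal_inf_tmp => _ [r Hr <-].
Qed.

Lemma limf_esup_le (l : R) :
  (forall eps : R, 0 < eps -> \forall r \near F, (h r <= (l + eps)%:E)%E) ->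
  (limf_esup h F <= l%:E)%E.
Proof.
move=> H; apply/lee_addgt0Pr => e e0; rewrite -EFinD limf_esupE.
pose V := [set r | (h r <= (l + e)%:E)%E].
apply: ge_ereal_inf; exists (ereal_sup (h @` V)); first by exists V => //; exact: H.
by apply: ge_ereal_sup => _ [r Hr <-].
Qed.

Lemma limf_einf_le_esup : (limf_einf h F <= limf_esup h F)%E.
Proof.
rewrite limf_einfE limf_esupE; apply: ge_ereal_sup => _ [V FV <-].
apply: le_ereal_inf_tmp => _ [W FW <-].
have [x [Vx Wx]] := @filter_ex _ _ _ _ (filterI FV FW).
apply: (@le_trans _ _ (h x)); first by apply: ereal_inf_lbound; exists x.
by apply: ereal_sup_ubound; exists x.
Qed.
End ExtendedLimits.

Section ScalingExponent.
Variables (R : realType) (d : nat) (b : R -> R).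
Hypothesis d_ge3 : (3 <= d)%N.
Hypothesis b_mono : forall r r', r <= r' -> b r <= b r'.
Hypothesis b_gt0 : forall r, 0 < r -> 0 < b r.
Let dR_gt0 : 0 < d%:R :> R. Proof. by rewrite ltr0n (leq_trans _ d_ge3). Qed.

Lemma ln_d_gt0 : 0 < ln d%:R :> R.
Proof. by rewrite ln_gt0 // ltr1n (leq_trans _ d_ge3). Qed.

Lemma ln_dX n : ln (d%:R^-1 ^+ n) = - (n%:R * ln d%:R) :> R.
Proof. by rewrite lnXn ?invr_gt0 // lnV ?posrE // mulNrn mulr_natl. Qed.

Lemma dX_gt0 n : 0 < d%:R^-1 ^+ n :> R.
Proof. by rewrite exprn_gt0 // invr_gt0. Qed.
Hint Resolve dX_gt0 : core.

Lemma scale_exists (N : nat) (r : R) : 0 < r -> r < d%:R^-1 ^+ N ->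
  exists n : nat, [/\ (N <= n)%N, d%:R^-1 ^+ n.+1 < r, r <= d%:R^-1 ^+ n,
    0 < - ln r & n%:R <= - ln r / ln d%:R < n%:R + 1].
Proof.
move=> r0 rN; have D0 := ln_d_gt0; pose t := - ln r / ln d%:R.
have tD : t * ln d%:R = - ln r by rewrite divfK // gt_eqF.
have Nt : N%:R < t.
  rewrite -(ltr_pM2r D0) tD ltrNr -ln_dX ltr_ln ?posrE //.
have t0 : 0 <= t by rewrite ltW // (le_lt_trans _ Nt).
have /andP[n1 n2] := truncn_itv t0; rewrite -natr1 in n2.
exists (Num.truncn t); split.
- by rewrite -ltnS -(ltr_nat R) -natr1 (lt_trans Nt).
- rewrite -ltr_ln ?posrE // ln_dX ltrNl -tD ltr_pM2r // -natr1 //.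
- by rewrite -ler_ln ?posrE // ln_dX lerNr -tD ler_pM2r.
- by rewrite -tD mulr_gt0 // (le_lt_trans _ Nt).
- by rewrite -/t n1.
Qed.

Lemma scaling_lower (alpha : R) :
  (forall eps : R, 0 < eps -> exists n0 : nat, forall n, (n0 <= n)%N ->
     ln (b (d%:R^-1 ^+ n)) <= - (alpha - eps) * n%:R) ->
  forall eps : R, 0 < eps -> \forall r \near 0^'+,
    alpha / ln d%:R - eps <= ln (b r) / ln r.
Proof.
(* Half of the tolerance goes to the hypothesis; the other half absorbs [|alpha - e|], the error of
   replacing [- ln r / ln d] by its integer part [n]. *)
move=> H eps e0; have D0 := ln_d_gt0; pose e := eps * ln d%:R / 2.
have {}e0 : 0 < e by rewrite divr_gt0 // mulr_gt0.
have [n0 Hn0] := H _ e0; have [n1 Hn1] := archi_ge (`|alpha - e| / e).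
near=> r.
have r0 : 0 < r by near: r; exact: nbhs_right_gt.
have rN : r < d%:R^-1 ^+ maxn n0 n1 by near: r; exact: nbhs_right_lt.
have [n [nN _ rn L0 /andP[t1 t2]]] := scale_exists r0 rN.
rewrite -[X in _ <= _ / X]opprK invrN mulrN -mulNr ler_pdivlMr //.
set L := - ln r in L0 t1 t2 *; set t := L / ln d%:R in t1 t2.
have -> : (alpha / ln d%:R - eps) * L = (alpha - 2 * e) * t.
  by rewrite /t /e; field; rewrite gt_eqF.
have bn : ln (b r) <= ln (b (d%:R^-1 ^+ n)) by rewrite ler_ln ?posrE ?b_gt0 // b_mono.
have := Hn0 n (leq_trans (leq_maxl _ _) nN).
have : `|alpha - e| <= e * n%:R.
  by rewrite mulrC -ler_pdivrMr // (le_trans Hn1) // ler_nat (leq_trans _ nN) // leq_maxr.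
have := ler_norm (alpha - e); have := ler_norm (- (alpha - e)); rewrite normrN.
have h : (alpha - e) * (t - n%:R) <= `|alpha - e|.
  rewrite (le_trans (ler_norm _)) // normrM ler_piMr //.
  by rewrite ler_norml; apply/andP; split; lra.
have et : e * n%:R <= e * t by rewrite ler_pM2l.
move: h; rewrite mulrBr; lra.
Unshelve. all: by end_near.
Qed.

(** All radii above [d^-n] appear in the hypothesis because adic intervals are only known to fit in
    balls of strictly larger radius. This uses [d^-(n+1) < r], where [scaling_lower] uses
    [r <= d^-n]. *)
Lemma scaling_upper (beta : R) :
  (forall eps : R, 0 < eps -> exists n0 : nat, forall n r, (n0 <= n)%N ->
     d%:R^-1 ^+ n < r -> - (beta + eps) * n%:R <= ln (b r)) ->
  forall eps : R, 0 < eps -> \forall r \near 0^'+,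
    ln (b r) / ln r <= beta / ln d%:R + eps.
Proof.
move=> H eps e0; have D0 := ln_d_gt0; pose e := eps * ln d%:R / 2.
have {}e0 : 0 < e by rewrite divr_gt0 // mulr_gt0.
have [n0 Hn0] := H _ e0; have [n1 Hn1] := archi_ge (`|beta + e| / e).
near=> r.
have r0 : 0 < r by near: r; exact: nbhs_right_gt.
have rN : r < d%:R^-1 ^+ maxn n0 n1 by near: r; exact: nbhs_right_lt.
have [n [nN rn _ L0 /andP[t1 t2]]] := scale_exists r0 rN.
rewrite -[X in _ / X <= _]opprK invrN mulrN -mulNr ler_pdivrMr //.
set L := - ln r in L0 t1 t2 *; set t := L / ln d%:R in t1 t2.
have -> : (beta / ln d%:R + eps) * L = (beta + 2 * e) * t.
  by rewrite /t /e; field; rewrite gt_eqF.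
have := Hn0 n.+1 r (leqW (leq_trans (leq_maxl _ _) nN)) rn; rewrite -natr1.
have : `|beta + e| <= e * n%:R.
  by rewrite mulrC -ler_pdivrMr // (le_trans Hn1) // ler_nat (leq_trans _ nN) // leq_maxr.
have h : (beta + e) * (n%:R + 1 - t) <= `|beta + e|.
  rewrite (le_trans (ler_norm _)) // normrM ler_piMr //.
  by rewrite ler_norml; apply/andP; split; lra.
have et : e * n%:R <= e * t by rewrite ler_pM2l.
move: h; rewrite mulrBr; lra.
Unshelve. all: by end_near.
Qed.
End ScalingExponent.

(** * Local dimensions from symbolic exponents *)

Section Spectrum.
Variables (R : realType) (d k : nat) (Lam : {set 'I_k.+1}) (p : 'I_k.+1 -> R).
Variable mu : probability (measurableTypeR R) R.
Hypothesis d_ge3 : (3 <= d)%N.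
Hypothesis k_gt0 : (0 < k)%N.
Hypothesis Lam0 : ord0 \in Lam.
Hypothesis Lamk : ord_max \in Lam.
Hypothesis p_gt0 : forall j, j \in Lam -> 0 < p j.
Hypothesis p_sum : \sum_(j in Lam) p j = 1.
Hypothesis mu_ss : self_similar_measure d Lam p mu.
Hypothesis Lam_col : forall (l : 'I_d) (i : 'I_k), exists2 s, s \in Lam &
  exists j : nat, (s * d.-1 + i = l + j * d)%N.
Variable B : seq 'I_d.
Let T := @trans_mx R d k Lam p.
Hypothesis B_pos : class_positive T B.

Let nu := quotient_measure mu.
Let f (w : seq 'I_d) : R := ln (mass T w).
Let dR_gt0 : 0 < d%:R :> R. Proof. by rewrite ltr0n (leq_trans _ d_ge3). Qed.

Let mass_gt0 w : 0 < mass T w.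
Proof.
have [q /andP[q0 _] Tq] := trans_mx_col d_ge3 p_gt0 Lam_col.
exact: (mass_gt0 k_gt0 q0 (trans_mx_ge0 d_ge3 p_gt0) Tq).
Qed.

Let massE w : mass T w = expR (f w).
Proof. by rewrite lnK // posrE. Qed.

Lemma cyl_mass_exp : exists2 c, 0 < c <= 1 &
  forall u : seq 'I_d, c * expR (f u) <= cyl_mass k mu u <= expR (f u).
Proof.
have [c c01 Hc] := cyl_mass_bounds d_ge3 k_gt0 Lam0 Lamk p_gt0 p_sum mu_ss Lam_col B_pos.
by exists c => // u; rewrite -massE.
Qed.

Lemma spectrum_words : exists E1 E2 : R,
  [/\ E1 <= E2, forall u, E1 * (size u)%:R <= f u,
    forall eps : R, 0 < eps -> exists n0 : nat, forall u, (n0 <= size u)%N ->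
      f u <= (E2 + eps) * (size u)%:R,
    forall t, E1 <= t <= E2 -> exists e, regular f (digit1 d_ge3) e t &
    forall t, E1 <= t <= E2 -> forall eps : R, 0 < eps -> exists w E e,
      [/\ class_positive T w /\ wt w = 0 %[mod d.-1], w != [::], digit1 d_ge3 \in w,
        forall n, onth w (n %% size w) = Some (e n) &
        regular f (digit1 d_ge3) e E /\ `|E - t| <= eps]].
Proof.
have [q /andP[q0 _] Tq] := trans_mx_col d_ge3 p_gt0 Lam_col.
have T0 := trans_mx_ge0 d_ge3 p_gt0.
have Tc := trans_mx_class (k := k) (Lam := Lam) (p := p) d_ge3.
have Ts := trans_mx_colsum d_ge3 p_gt0 p_sum.
have [C [fC f_con f_loop]] := ln_mass_connect d_ge3 k_gt0 q0 T0 Tc Tq Ts B_pos.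
apply: word_spectrum fC _ f_con f_loop.
- by move=> u v; exact: (ln_mass_cat k_gt0 q0 T0 Tq).
- by move=> u; exact: (ln_mass_ge k_gt0 q0 T0 Tq).
Qed.

(** Excludes the value [lne 0 = -oo], so that dimension quotients are real numbers. A ball contains
    an adic interval up to integer translation, and [E1] bounds the mass of that interval below. *)
Lemma ball_mass_gt0 (x : circle R) r : 0 < r -> 0 < ball_mass mu x r.
Proof.
move=> r0; have [c /andP[c0 _] Hc] := cyl_mass_exp.
have [E1 [_ [_ E1f _ _ _]]] := spectrum_words.
have [n Hn] := archi_ge r^-1.
have nr : d%:R^-1 ^+ n < r.
  rewrite exprVn invf_plt ?posrE ?exprn_gt0 // (le_lt_trans Hn) // -natrX ltr_nat.
  by rewrite ltn_expl // (leq_trans _ d_ge3).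
apply: lt_le_trans (ball_mass_ge_min (M := c * expR (E1 * n%:R)) d_ge3 x _ nr).
  by rewrite mulr_gt0 ?expR_gt0.
move=> u un; have /andP[Hu _] := Hc u; apply: le_trans Hu.
by rewrite ler_pM2l // ler_expR -un.
Qed.

Lemma dim_quotientE x r : 0 < r ->
  dim_quotient nu x r = (ln (ball_mass mu x r) / ln r)%:E.
Proof.
by move=> r0; rewrite /dim_quotient /nu quotient_measure_ball lne_EFin ?ball_mass_gt0.
Qed.

Lemma lower_locdim_ge x alpha :
  (forall eps : R, 0 < eps -> exists n0 : nat, forall n, (n0 <= n)%N ->
     ln (ball_mass mu x (d%:R^-1 ^+ n)) <= - (alpha - eps) * n%:R) ->
  ((alpha / ln d%:R)%:E <= lower_locdim nu x)%E.
Proof.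
move=> H; apply: limf_einf_ge => eps e0.
have := scaling_lower d_ge3 (ball_mass_mono mu x) (@ball_mass_gt0 x) H e0.
apply: filterS2 (nbhs_right_gt 0) => r r0 h.
by rewrite dim_quotientE // lee_fin.
Qed.

Lemma upper_locdim_le x beta :
  (forall eps : R, 0 < eps -> exists n0 : nat, forall n r, (n0 <= n)%N ->
     d%:R^-1 ^+ n < r -> - (beta + eps) * n%:R <= ln (ball_mass mu x r)) ->
  (upper_locdim nu x <= (beta / ln d%:R)%:E)%E.
Proof.
move=> H; apply: limf_esup_le => eps e0.
have := scaling_upper d_ge3 H e0.
apply: filterS2 (nbhs_right_gt 0) => r r0 h.
by rewrite dim_quotientE // lee_fin.
Qed.

Lemma lower_le_upper x : (lower_locdim nu x <= upper_locdim nu x)%E.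
Proof. exact: limf_einf_le_esup. Qed.

Lemma regular_locdim e t : regular f (digit1 d_ge3) e t ->
  has_locdim nu (digit_point R e) (- t / ln d%:R)%:E.
Proof.
move=> [reg gap]; have [c /andP[c0 c1] Hc] := cyl_mass_exp.
have lo : ((- t / ln d%:R)%:E <= lower_locdim nu (digit_point R e))%E.
  apply: lower_locdim_ge => eps e0.
  (* [e1 <= 1/2] keeps the position [m] found below at least [n / 2], hence beyond [n0]; the other
     bound covers both the gap [n - m] and the error of [f] at [m]. *)
  pose e1 := Num.min 2^-1 (eps / (`|t| + 1)); have t0 := normr_ge0 t.
  have e10 : 0 < e1 by rewrite lt_min invr_gt0 ltr0n /= divr_gt0 //; lra.
  have e12 : e1 <= 2^-1 by rewrite ge_min lexx.
  have e1t : e1 * (`|t| + 1) <= eps.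
    by rewrite -ler_pdivlMr ?ge_min ?lexx ?orbT //; lra.
  have [n0 Hn0] := reg _ e10; have [n1 Hn1] := gap _ e10.
  exists (maxn (2 * n0) n1) => n; rewrite geq_max => /andP[nn0 nn1].
  (* At the digit 1 in position [m < n], even the larger ball of radius [d^-(m+1)] stays inside one
     adic interval of level [m]. *)
  have [m [mn m1 em]] := Hn1 _ nn1.
  have nR0 : 0 <= n%:R :> R by [].
  have mn' : m%:R <= n%:R :> R by rewrite ler_nat ltnW.
  have n0m : (n0 <= m)%N.
    rewrite -(ler_nat R).
    have : (2 * n0)%:R <= n%:R :> R by rewrite ler_nat.
    rewrite natrM; nra.
  have /andP[_ Hm] := Hc (mkseq e m).
  have b1 : ball_mass mu (digit_point R e) (d%:R^-1 ^+ n) <= expR (f (mkseq e m)).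
    have hb := digit_ball_le k_gt0 Lam0 Lamk p_gt0 p_sum mu_ss em.
    apply: le_trans Hm; apply: le_trans hb; apply: ball_mass_mono.
    rewrite ler_wiXn2l // ?invr_ge0 ?ltW // invf_lt1 //.
    by rewrite ltr1n (leq_trans _ d_ge3).
  rewrite (@le_trans _ _ (f (mkseq e m))) //.
    by rewrite -[leRHS]expRK ler_ln ?posrE ?expR_gt0 // ball_mass_gt0 // dX_gt0.
  have := Hn0 _ n0m; rewrite ler_norml => /andP[_ h].
  have h2 : t * (m%:R - n%:R) <= `|t| * (e1 * n%:R).
    rewrite (le_trans (ler_norm _)) // normrM ler_wpM2l // ler_norml.
    by apply/andP; split; nra.
  have h3 : e1 * (`|t| + 1) * n%:R <= eps * n%:R by rewrite ler_wpM2r.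
  have h4 : e1 * m%:R <= e1 * n%:R by rewrite ler_pM2l.
  move: h2 h3; rewrite mulrBr mulrDr mulrDl; lra.
have up : (upper_locdim nu (digit_point R e) <= (- t / ln d%:R)%:E)%E.
  apply: upper_locdim_le => eps e0; have e2 : 0 < eps / 2 by lra.
  have [n0 Hn0] := reg _ e2; have [n1 Hn1] := archi_ge (- ln c / (eps / 2)).
  exists (maxn n0 n1) => n r; rewrite geq_max => /andP[nn0 nn1] nr.
  have /andP[Hm _] := Hc (mkseq e n).
  have b1 := le_trans Hm (digit_ball_ge k mu d_ge3 e nr).
  have r0 : 0 < r by apply: lt_trans nr; exact: dX_gt0.
  apply: (@le_trans _ _ (ln (c * expR (f (mkseq e n))))); last first.
    by rewrite ler_ln ?posrE ?mulr_gt0 ?expR_gt0 ?ball_mass_gt0.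
  rewrite lnM ?posrE ?expR_gt0 // expRK.
  have := Hn0 _ nn0; rewrite ler_norml => /andP[h _].
  have : - ln c <= eps / 2 * n%:R.
    by rewrite mulrC -ler_pdivrMr // (le_trans Hn1) // ler_nat.
  lra.
have lu := lower_le_upper (digit_point R e).
split; apply/eqP; rewrite eq_le.
  by rewrite up (le_trans lo lu).
by rewrite lo (le_trans lu up).
Qed.

Lemma locdim_bounds (E1 E2 : R) :
  (forall u, E1 * (size u)%:R <= f u) ->
  (forall eps : R, 0 < eps -> exists n0 : nat, forall u, (n0 <= size u)%N ->
      f u <= (E2 + eps) * (size u)%:R) ->
  forall x, ((- E2 / ln d%:R)%:E <= lower_locdim nu x)%E /\
    (upper_locdim nu x <= (- E1 / ln d%:R)%:E)%E.
Proof.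
move=> E1f E2f x; have [c /andP[c0 c1] Hc] := cyl_mass_exp; split.
- apply: lower_locdim_ge => eps e0; have e2 : 0 < eps / 2 by lra.
  have [n0 Hn0] := E2f _ e2; have [n1 Hn1] := archi_ge (ln 3 / (eps / 2)).
  exists (maxn n0 n1) => n; rewrite geq_max => /andP[nn0 nn1].
  have b1 : ball_mass mu x (d%:R^-1 ^+ n) <= 3 * expR ((E2 + eps / 2) * n%:R).
    apply: (ball_mass_le3 d_ge3 k_gt0 Lam0 Lamk p_gt0 p_sum mu_ss) => u un.
    have /andP[_ Hu] := Hc u; apply: (le_trans Hu).
    by rewrite ler_expR -un Hn0 // un.
  apply: (@le_trans _ _ (ln (3 * expR ((E2 + eps / 2) * n%:R)))).
    by rewrite ler_ln ?posrE ?mulr_gt0 ?expR_gt0 // ball_mass_gt0 // dX_gt0.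
  rewrite lnM ?posrE ?expR_gt0 // expRK.
  have : ln 3 <= eps / 2 * n%:R.
    by rewrite mulrC -ler_pdivrMr // (le_trans Hn1) // ler_nat.
  lra.
- apply: upper_locdim_le => eps e0.
  have [n1 Hn1] := archi_ge (- ln c / eps).
  exists n1 => n r nn1 nr.
  have r0 : 0 < r by apply: lt_trans nr; exact: dX_gt0.
  have b1 : c * expR (E1 * n%:R) <= ball_mass mu x r.
    apply: (ball_mass_ge_min d_ge3 x _ nr) => u un.
    have /andP[Hu _] := Hc u; apply: le_trans Hu.
    by rewrite ler_pM2l // ler_expR -un.
  apply: (@le_trans _ _ (ln (c * expR (E1 * n%:R)))); last first.
    by rewrite ler_ln ?posrE ?mulr_gt0 ?expR_gt0 ?ball_mass_gt0.
  rewrite lnM ?posrE ?expR_gt0 // expRK.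
  have : - ln c <= eps * n%:R.
    by rewrite mulrC -ler_pdivrMr // (le_trans Hn1) // ler_nat.
  lra.
Qed.
End Spectrum.

(** * The permuted block matrices *)

Section PermutedBlocks.
Variables (R : realType) (d k : nat) (Lam : {set 'I_k.+1}) (p : 'I_k.+1 -> R).
Hypothesis d_ge3 : (3 <= d)%N.
Hypothesis d_le_k : (d.-1 <= k)%N.
Let T := @trans_mx R d k Lam p.

Let d1_gt0 : (0 < d.-1)%N. Proof. by case: (d) d_ge3 => [|[]]. Qed.

Lemma block_index_lt (i : 'I_d.-1) (i' : 'I_(block_size k i)) : (i + i' * d.-1 < k)%N.
Proof.
have ik : (i.+1 <= k)%N := leq_trans (ltn_ord i) d_le_k.
have := ltn_ord i'; rewrite {2}/block_size ltnS leq_divRL // => h.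
by rewrite -addSn -leq_subRL.
Qed.

Definition block_index (i : 'I_d.-1) (i' : 'I_(block_size k i)) : 'I_k :=
  Ordinal (block_index_lt i').

(** Block [i] lists the indices below [k] congruent to [i]. Summing over blocks is thus a reordered
    full sum, and block products agree with permuted ordinary products. *)
Lemma block_index_sum (F : 'I_k -> R) :
  \sum_(i < d.-1) \sum_(i' < block_size k i) F (block_index i') = \sum_j F j.
Proof.
rewrite [RHS](partition_big (fun j : 'I_k => Ordinal (ltn_pmod j d1_gt0)) xpredT) //=.
apply: eq_bigr => i _.
rewrite [RHS](reindex_onto (@block_index i)
  (fun j => inord (j %/ d.-1) : 'I_(block_size k i))) /=.
  apply: eq_bigl => i'; apply/esym/andP; split.
    by rewrite -val_eqE /= addnC modnMDl modn_small.
  rewrite -val_eqE /= inordK addnC divnMDl // divn_small ?addn0 //.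
move=> j /eqP ji; apply/val_inj; rewrite /= inordK.
  by rewrite -ji /= addnC -divn_eq.
rewrite /block_size ltnS leq_divRL // leq_subRL ?(leq_trans (ltn_ord i)) //.
by rewrite addSn -ji /= addnC -divn_eq.
Qed.

Lemma permuted_trans_wordE (w : seq 'I_d) : w != [::] ->
  permuted_trans_word Lam p w = \mxblock_(i, j)
    \matrix_(i' < block_size k i, j' < block_size k j)
      trans_prod T w (block_index i') (block_index j').
Proof.
case: w => // l w _; elim: w l => [|l' w IH] l.
  rewrite /permuted_trans_word /trans_prod !big_cons !big_nil !mulmx1.
  apply: eq_mxblock => i j; apply/matrixP => i' j'; rewrite !mxE //.
rewrite /permuted_trans_word big_cons -/(permuted_trans_word Lam p (l' :: w)) IH.
rewrite /permuted_trans mul_mxblock; apply: eq_mxblock => i j.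
apply/matrixP => i' j'; rewrite [RHS]mxE [in RHS]trans_prod_cons [RHS]mxE.
rewrite -(block_index_sum (fun m => T l (block_index i') m *
  trans_prod T (l' :: w) m (block_index j'))) summxE.
by apply: eq_bigr => b _; rewrite mxE; apply: eq_bigr => b' _; rewrite !mxE.
Qed.

Lemma blk_permuted (w : seq 'I_d) i j i' j' : w != [::] ->
  blk (permuted_trans_word Lam p w) i j i' j' =
  trans_prod T w (block_index i') (block_index j').
Proof. by move=> w0; rewrite permuted_trans_wordE // /blk mxblockK mxE. Qed.

Lemma block_index_ex (j : 'I_k) : exists i (i' : 'I_(block_size k i)), j = block_index i'.
Proof.
pose i := Ordinal (ltn_pmod j d1_gt0).
have h : (j %/ d.-1 < block_size k i)%N.
  rewrite /block_size ltnS leq_divRL // leq_subRL; last first.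
    by rewrite (leq_trans _ d_le_k) // ltn_ord.
  by rewrite addSn /= addnC -divn_eq.
by exists i, (Ordinal h); apply/val_inj; rewrite /= addnC -divn_eq.
Qed.

Lemma block_index_mod (i : 'I_d.-1) (i' : 'I_(block_size k i)) :
  block_index i' = i %[mod d.-1].
Proof. by rewrite /= addnC modnMDl. Qed.

Hypothesis p_gt0 : forall j, j \in Lam -> 0 < p j.

Lemma block_positive_class (w : seq 'I_d) : w != [::] ->
  block_positive (permuted_trans_word Lam p w) -> class_positive T w.
Proof.
move=> w0 [r _ pos].
(* The type is only known to exist; one positive entry in block row 0 identifies it with the total
   digit sum. *)
have rE : r = wt w %[mod d.-1].
  pose i := Ordinal d1_gt0; pose j := Ordinal (ltn_pmod r d1_gt0).
  have ij : (i + r == j %[mod d.-1])%N by rewrite /= modn_mod add0n.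
  have := pos i j ij ord0 ord0; rewrite blk_permuted // => /lt0r_neq0.
  move=> /(trans_prod_class (trans_mx_ge0 d_ge3 p_gt0) (trans_mx_class d_ge3)).
  by rewrite -modnDml !block_index_mod /= mod0n add0n modn_mod.
move=> j i ji; have [a [a' jE]] := block_index_ex j; have [b [b' iE]] := block_index_ex i.
rewrite jE iE -blk_permuted //; apply: pos; rewrite -modnDmr rE modnDmr.
by rewrite -(block_index_mod b') -iE ji jE -[X in _ == X]modnDml block_index_mod modnDml.
Qed.

Lemma class_block_positive (w : seq 'I_d) : w != [::] -> class_positive T w ->
  wt w = 0 %[mod d.-1] -> block_diagonal (permuted_trans_word Lam p w) /\
    block_positive (permuted_trans_word Lam p w).
Proof.
move=> w0 wp w_0.
have pos (i j : 'I_d.-1) i' j' : (i + 0 == j %[mod d.-1])%N ->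
    0 < blk (permuted_trans_word Lam p w) i j i' j'.
  move=> /eqP ij; rewrite blk_permuted //; apply: wp.
  by rewrite -[RHS]modnDmr w_0 modnDmr addn0 !block_index_mod -ij addn0.
have bd : block_diagonal (permuted_trans_word Lam p w).
  move=> i j; case: ifPn => [ij|/negP nij].
    by split=> [i'|j']; exists ord0; rewrite gt_eqF // pos.
  apply/matrixP => i' j'; rewrite blk_permuted // mxE; apply/eqP/negPn/negP => nz.
  apply: nij; rewrite addn0 -(block_index_mod i') -(block_index_mod j').
  rewrite (trans_prod_class (trans_mx_ge0 d_ge3 p_gt0) (trans_mx_class d_ge3) nz).
  by rewrite -[X in _ == X]modnDmr w_0 modnDmr addn0.
split=> //; exists 0%N; first exact: bd.
by move=> i j ij i' j'; exact: pos.
Qed.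
End PermutedBlocks.

(** * The spectrum *)

(** Multiplication by [d ^ q] turns an adic point of level at most [q] into an integer. If digit [q]
    is 1, the product here lies between [N + 1/d] and [N + 2/d], and [2 < d]. *)
Lemma interior_digit_point (R : realType) (d : nat) (d_ge3 : (3 <= d)%N)
    (e : nat -> 'I_d) :
  (forall N : nat, exists2 n, (N <= n)%N & e n = digit1 d_ge3) ->
  interior_point d (digit_point R e).
Proof.
move=> inf_1 j n /circle_projP /intrP[m]; rewrite -/(digit_val R e) => E.
have [q nq eq1] := inf_1 n.
have dR_gt0 : 0 < d%:R :> R by rewrite ltr0n (leq_trans _ d_ge3).
have dR3 : 3 <= d%:R :> R by rewrite ler_nat.
have dq0 : 0 < d%:R ^+ q :> R by rewrite exprn_gt0.
have := digit_val_itv R d_ge3 e q.+1; have [N] := word_val_nat R d_ge3 (mkseq e q).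
rewrite mkseqS word_val_rcons size_mkseq eq1 /= mul1r => HN /andP[a b].
set h := d%:R^-1 ^+ q.+1 in a b.
have hq : d%:R * (h * d%:R ^+ q) = 1.
  by rewrite /h exprS mulrA mulrA divff ?gt_eqF // mul1r -exprMn mulVf ?expr1n // gt_eqF.
have h0 : 0 < h * d%:R ^+ q by rewrite mulr_gt0 // exprn_gt0 // invr_gt0.
have zE : digit_val R e * d%:R ^+ q = (j * (d ^ (q - n))%:Z + m * (d ^ q)%:Z)%:~R.
  have {}E : digit_val R e = j%:~R / d%:R ^+ n + m%:~R by rewrite -E addrC subrK.
  rewrite E mulrDl intrD !intrM -![(_ ^ _)%:Z%:~R]/((_ ^ _)%:R) !natrX.
  congr (_ + _); rewrite -[in LHS](subnK nq) exprD [_ ^+ (q - n) * _]mulrC mulrA.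
  by rewrite divfK // expf_neq0 // gt_eqF.
have l1 : N%:R < digit_val R e * d%:R ^+ q.
  have := ler_wpM2r (ltW dq0) a; rewrite mulrDl HN; lra.
have l2 : digit_val R e * d%:R ^+ q < N%:R + 1.
  have := ler_wpM2r (ltW dq0) b; rewrite !mulrDl HN; nra.
move: l1 l2; rewrite zE -[N%:R]/(N%:Z%:~R) -intrD1 !ltr_int.
set zz := _ + _; lia.
Qed.

(** Completeness at level 1 suffices: that [i] is a neighbour of [[l/d, (l+1)/d]] means
    [i = l + j d - s (d - 1)], which is the equation of a non-zero entry in column [i]. *)
Lemma cantor_like_col (R : realType) (d k : nat) (Lam : {set 'I_k.+1}) (K : set R) :
  (3 <= d)%N -> complete_cantor_like d Lam K ->
  forall (l : 'I_d) (i : 'I_k), exists2 s, s \in Lam &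
  exists j : nat, (s * d.-1 + i = l + j * d)%N.
Proof.
move=> d_ge3 /(_ 1%N isT) [netE nbE] l i.
have dR_neq0 : d%:R != 0 :> R by rewrite pnatr_eq0; case: (d) d_ge3.
have : net_intervals d Lam K 1 (adic_interval R d 1 l).
  by rewrite netE; exists (l : nat) => //=; rewrite expn1.
move=> /nbE nbD; have : [set i%:R | i in `I_k] (i%:R : R) by exists (i : nat) => /=.
rewrite -nbD => -[s [j [sL _]]].
case/tupleP: s sL => s t; rewrite (tuple0 t) mem_enum inE /= andbT => sL.
rewrite /simS /= mul0r add0r !expr1 => E; exists s => //; exists j.
apply/eqP; rewrite -(eqr_nat R) !natrD E !natrM; apply/eqP; field.
by [].
Qed.

(** * The full digit set *)

Section FullDigits.
Variables (R : realType) (d k : nat) (p : 'I_k.+1 -> R).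
Hypothesis d_ge3 : (3 <= d)%N.
Hypothesis d_le_k : (d.-1 <= k)%N.
Hypothesis p_gt0 : forall j, 0 < p j.
Let T := @trans_mx R d k [set: 'I_k.+1]%SET p.
Let d1_gt0 : (0 < d.-1)%N. Proof. by case: (d) d_ge3 => [|[]]. Qed.
Let d_gt0 : (0 < d)%N. Proof. exact: leq_trans d_ge3. Qed.

Lemma full_col (l : 'I_d) (i : 'I_k) : exists2 s, s \in [set: 'I_k.+1]%SET &
  exists j : nat, (s * d.-1 + i = l + j * d)%N.
Proof.
(* As [d - 1 = -1] mod [d], the equation forces [s = i - l] mod [d]; the reduced residue is a digit
   because [d - 1 <= k]. *)
pose x := (i + (d - l))%N; pose s := (x %% d)%N.
have sd : (s < d)%N by rewrite ltn_mod.
have sk : (s < k.+1)%N by rewrite ltnS; lia.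
exists (Ordinal sk); first by rewrite inE.
exists (s + x %/ d).-1 => /=; set y := (x %/ d)%N.
have xE : (i + (d - l) = y * d + s)%N := divn_eq x d.
have ld := ltn_ord l.
have sy : (0 < s + y)%N by case: (s) (y) xE => [|?] [|?]; lia.
have sE : (s * d = s * d.-1 + s)%N by rewrite -mulnSr prednK.
have nE : ((s + y).-1 * d + d = s * d + y * d)%N by rewrite -mulSnr prednK // mulnDl.
lia.
Qed.

(* [sigma] is the base-[d] value of the digits [s] used along a path; such
   values fill the whole range because [k >= d - 1], which is where the
   greedy digit [minn k (sigma %/ d ^ n)] comes from. *)
Lemma full_path n (v sigma : nat) (j i : 'I_k) :
  (d.-1 * v + 1 = d ^ n)%N -> (sigma * d.-1 + i = v + j * d ^ n)%N ->
  (sigma * d.-1 <= k * (d ^ n - 1))%N ->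
  0 < trans_prod T (nseq n (digit1 d_ge3)) j i.
Proof.
elim: n v sigma j i => [|n IH] v sigma j i vE sE sle.
  rewrite /trans_prod big_nil mxE; suff -> : j = i by rewrite eqxx ltr01.
  apply/val_inj => /=; move: vE sE sle; rewrite expn0 => vE sE sle.
  have v0 : v = 0%N by nia.
  have : (sigma * d.-1 = 0)%N by nia.
  by move=> s0; rewrite s0 v0 muln1 in sE.
set D := (d ^ n)%N; set c := d.-1.
have D0 : (0 < D)%N by rewrite expn_gt0 d_gt0.
have dD : (d ^ n.+1 = c * D + D)%N by rewrite expnS -mulSnr prednK.
have c2 : (2 <= c)%N by rewrite -ltnS prednK.
have ck : (c <= k)%N := d_le_k.
rewrite dD -/c in vE sE sle.
have Dv : (D <= v)%N by rewrite -(leq_pmul2l d1_gt0) -/c; lia.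
(* [v] is the base-[d] value of the word of ones; dropping its leading digit subtracts
   [D = d ^ n]. *)
pose v' := (v - D)%N; have vv' : v = (v' + D)%N by rewrite subnK.
have v'E : (c * v' + 1 = D)%N by move: vE; rewrite vv' mulnDr; lia.
pose s := minn k (sigma %/ D); pose sigma' := (sigma - s * D)%N.
have sD : (s * D <= sigma)%N.
  by rewrite (leq_trans _ (leq_trunc_div sigma D)) // leq_mul2r geq_minr orbT.
have sig : sigma = (sigma' + s * D)%N by rewrite subnK.
have sig'le : (sigma' * c <= k * (D - 1))%N.
  (* If the greedy digit saturates at [k], the bound follows from that on [sigma]. Otherwise
     [sigma'] is a remainder mod [D], at most [D - 1], and [d - 1 <= k]. *)
  have [kle|/ltnW klt] := leqP k (sigma %/ D).
    have sk : s = k by apply/minn_idPl.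
    move: sle; rewrite sig sk mulnDl !mulnBr !muln1; have := leq_pmulr k D0; lia.
  have -> : sigma' = (sigma %% D)%N.
    by rewrite /sigma' /s (minn_idPr klt) {1}(divn_eq sigma D) addKn.
  by rewrite mulnC leq_mul // leq_subRL // add1n ltn_mod.
(* The next index is [1 + j d - s c] and must not be negative; otherwise [2 D <= v], which
   contradicts [c v + 1 = d D] since [c >= 2]. *)
have sc : (s * c <= 1 + j * d)%N.
  rewrite leqNgt; apply/negP => h.
  have : ((2 + j * d) * D <= s * c * D)%N by rewrite leq_mul2r h orbT.
  have : (s * c * D + i <= v + j * (c * D + D))%N by rewrite -sE sig mulnDl; lia.
  have : (d = c + 1)%N by rewrite addn1 prednK.
  move=> -> h1 h2; have v2 : (2 * D <= v)%N by lia.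
  have : (c * (2 * D) <= c * v)%N by rewrite leq_mul2l v2 orbT.
  have : (2 * D <= c * D)%N by rewrite leq_mul2r c2 orbT.
  lia.
pose j' := (1 + j * d - s * c)%N; have j'E : (j' + s * c = 1 + j * d)%N by rewrite subnK.
have sE' : (sigma' * c + i = v' + j' * D)%N.
  have : ((j' + s * c) * D = (1 + j * d) * D)%N by rewrite j'E.
  have : (d = c + 1)%N by rewrite addn1 prednK.
  by move: sE; rewrite sig vv' => + ->; lia.
have j'k : (j' < k)%N.
  rewrite -(ltn_pmul2r D0); have := ltn_ord i; have := leq_pmulr k D0.
  by move: sig'le; rewrite mulnBr muln1; lia.
rewrite /= trans_prod_cons mxE (bigD1 (Ordinal j'k)) //= ltr_wpDr //.
  rewrite sumr_ge0 // => m _; rewrite mulr_ge0 ?trans_prod_ge0 ?trans_mx_ge0 //.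
  by move=> *; exact: trans_mx_ge0.
apply: mulr_gt0; last exact: (IH v' sigma').
have sk : (s < k.+1)%N by rewrite ltnS geq_minl.
rewrite mxE trans_entryE // (bigD1 (Ordinal sk)) /=; last first.
  by rewrite inE addnC j'E eqxx.
by rewrite ltr_wpDr // sumr_ge0 // => ? _; rewrite ltW.
Qed.

(** The congruence makes [v + j d^k - i] divisible by [d - 1], and the quotient is the [sigma] of
    [full_path]. Length [k] gives [v >= k]; with [2 v < d^k] this keeps the number between 0 and
    [k (d^k - 1)]. *)
Lemma full_class_positive : class_positive T (nseq k (digit1 d_ge3)).
Proof.
have val n : exists v, [/\ (d.-1 * v + 1 = d ^ n)%N, v = n %[mod d.-1] & (n <= v)%N].
  elim: n => [|n [v [vE vn nv]]]; first by exists 0%N; rewrite muln0.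
  exists (d * v + 1)%N; split.
  - by rewrite expnS -vE -[in X in _ = (X * _)%N](prednK d_gt0); nia.
  - rewrite -{1}(prednK d_gt0) mulSn [(d.-1 * v)%N]mulnC -addnA addnCA modnMDl.
    by rewrite -modnDml vn modnDml addn1.
  - by nia.
have [v [vE vk kv]] := val k; have d1_2 : (2 <= d.-1)%N by rewrite -ltnS prednK.
move=> j i; rewrite /wt big_nseq iter_addn_0 mul1n => ji.
have jk := ltn_ord j; have ik := ltn_ord i.
have ge : (i <= v + j * d ^ k)%N by lia.
have dv : (d.-1 %| v + j * d ^ k - i)%N.
  rewrite -eqn_mod_dvd // -vE mulnDr muln1 [(j * (_ * _))%N]mulnCA.
  by rewrite [(d.-1 * (_ * _))%N]mulnC addnCA modnMDl -modnDml vk modnDml addnC ji.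
apply: (@full_path k v ((v + j * d ^ k - i) %/ d.-1) j i) => //.
  by rewrite divnK // subnK.
have cv : (2 * v <= d.-1 * v)%N by rewrite leq_mul2r d1_2 orbT.
have jD : (j * d ^ k + d ^ k <= k * d ^ k)%N by rewrite -mulSnr leq_mul2r jk orbT.
by rewrite divnK // mulnBr muln1; lia.
Qed.
End FullDigits.

(** The form common to both halves: [cantor_like_col] and [block_positive_class] supply the column
    condition and the word [B] in the first, [full_col] and [full_class_positive] in the second. *)
Theorem locdim_spectrum_interval (R : realType) (d k : nat) (Lam : {set 'I_k.+1})
    (p : 'I_k.+1 -> R) (mu : probability (measurableTypeR R) R) (B : seq 'I_d) :
  (3 <= d)%N -> (d.-1 <= k)%N -> ord0 \in Lam -> ord_max \in Lam ->
  (forall j, j \in Lam -> 0 < p j) -> \sum_(j in Lam) p j = 1 ->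
  self_similar_measure d Lam p mu ->
  (forall (l : 'I_d) (i : 'I_k), exists2 s, s \in Lam &
     exists j : nat, (s * d.-1 + i = l + j * d)%N) ->
  class_positive (@trans_mx R d k Lam p) B ->
  exists a b : R, a <= b /\
    let I : set (\bar R) := EFin @` `[a, b] in
    let mu_pi := quotient_measure mu in
    [/\ closure (locdims_on mu_pi
              (@block_diag_pos_interior_periodic R d k Lam p)) = I,
        locdims_on mu_pi setT = I,
        range (upper_locdim mu_pi) = I &
        range (lower_locdim mu_pi) = I].
Proof.
move=> d3 dk L0 Lk p0 p1 ss col Bp.
have k0 : (0 < k)%N by apply: leq_trans dk; case: (d) d3 => [|[]].
have D0 : 0 < ln d%:R :> R := ln_d_gt0 R d3.
have [E1 [E2 [E12 E1f E2f reg per]]] := spectrum_words d3 k0 p0 p1 col Bp.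
have bnd := locdim_bounds d3 k0 L0 Lk p0 p1 ss col Bp E1f E2f.
have regd := fun e t => @regular_locdim R d k Lam p mu d3 k0 L0 Lk p0 p1 ss col B Bp e t.
set mu_pi := quotient_measure mu in bnd regd *.
pose a := - E2 / ln d%:R; pose b := - E1 / ln d%:R.
have ab : a <= b by rewrite ler_pM2r ?invr_gt0 // lerN2.
have in_I (v : \bar R) : (a%:E <= v)%E -> (v <= b%:E)%E -> (EFin @` `[a, b]) v.
  case: v => [r| |] //=; rewrite ?lee_fin => ar rb.
  by exists r => //; rewrite in_itv /= ar.
have lu x : (lower_locdim mu_pi x <= upper_locdim mu_pi x)%E := lower_le_upper mu x.
have lowI x : (EFin @` `[a, b]) (lower_locdim mu_pi x).
  by have [l u] := bnd x; apply: in_I => //; exact: le_trans (lu x) u.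
have upI x : (EFin @` `[a, b]) (upper_locdim mu_pi x).
  by have [l u] := bnd x; apply: in_I => //; exact: le_trans l (lu x).
have tE v : v \in `[a, b] -> E1 <= - v * ln d%:R <= E2.
  rewrite in_itv /= => /andP[av vb]; apply/andP; split.
    by rewrite mulNr lerNr -ler_pdivlMr.
  by rewrite mulNr lerNl -ler_pdivrMr.
have ex v : v \in `[a, b] -> exists x, has_locdim mu_pi x v%:E.
  move=> /tE /reg[e /regd h]; exists (digit_point R e).
  by rewrite (_ : v = - (- v * ln d%:R) / ln d%:R) //; field; rewrite gt_eqF.
exists a, b; split=> //=; split.
- apply/seteqP; split.
    have cl : closed (EFin @` `[a, b] : set (\bar R)).
      rewrite (_ : _ @` _ = [set x | (a%:E <= x)%E] `&` [set x | (x <= b%:E)%E]).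
        apply: closedI; [exact: closed_ereal_le_ereal|exact: closed_ereal_ge_ereal].
      apply/seteqP; split=> [_ [r + <-]|v [av vb]]; last exact: in_I.
      by rewrite /= in_itv /= !lee_fin => /andP.
    rewrite [X in _ `<=` X](closure_id _).1 //; apply: closure_subset.
    by move=> v [x _ [<- _]].
  move=> _ [v vI <-] V /nbhs_EFin /nbhs_ballP[e /= e0 Ve].
  (* Exponents of [f] are [- ln d] times dimensions; halving [e] makes the final inequality
     strict. *)
  have eD : 0 < e / 2 * ln d%:R by rewrite mulr_gt0 // divr_gt0.
  have [w [E [s [[wp w0] wn ow ws [sreg sE]]]]] := per _ (tE _ vI) _ eD.
  exists (- E / ln d%:R)%:E; split; last first.
    apply: Ve; rewrite /ball /= (_ : v - _ = (E - - v * ln d%:R) / ln d%:R); last first.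
      by field; rewrite gt_eqF.
    rewrite normrM [`|_^-1|]gtr0_norm ?invr_gt0 // ltr_pdivrMr //.
    by rewrite (le_lt_trans sE) // ltr_pM2r //; lra.
  exists (digit_point R s); last exact: regd.
  split.
    apply: (interior_digit_point (d_ge3 := d3)) => N.
    have sw : (0 < size w)%N by case: (w) wn.
    exists (N * size w + index (digit1 d3) w)%N.
      by rewrite (leq_trans _ (leq_addr _ _)) // leq_pmulr.
    have := ws (N * size w + index (digit1 d3) w)%N.
    rewrite modnMDl modn_small ?index_mem // onthE (nth_map (digit1 d3)) ?index_mem //.
    by rewrite nth_index // => -[].
  exists w; last exact: class_block_positive.
  by split=> //; exists s; split=> //; exists 0%N => n; rewrite add0n.
- apply/seteqP; split; first by move=> v [x _ [<- _]].
  by move=> _ [v vI <-]; have [x hx] := ex v vI; exists x.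
- apply/seteqP; split; first by move=> _ [x _ <-].
  by move=> _ [v vI <-]; have [x [hx _]] := ex v vI; exists x.
- apply/seteqP; split; first by move=> _ [x _ <-].
  by move=> _ [v vI <-]; have [x [_ hx]] := ex v vI; exists x.
Qed.

Theorem corollary4p14 (R : realType) :
  (forall (d k : nat) (Lam : {set 'I_k.+1}) (p : 'I_k.+1 -> R)
      (K : set R) (mu : probability (measurableTypeR R) R),
    (3 <= d)%N -> (d.-1 <= k)%N ->
    ord0 \in Lam -> ord_max \in Lam ->
    (forall j, j \in Lam -> 0 < p j) -> \sum_(j in Lam) p j = 1 ->
    self_similar_set d Lam K ->
    self_similar_measure d Lam p mu ->
    complete_cantor_like d Lam K ->
    admits_block_positive d Lam p ->
    exists a b : R, a <= b /\
      let I : set (\bar R) := EFin @` `[a, b] in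
      let mu_pi := quotient_measure mu in
      [/\ closure (locdims_on mu_pi
                (@block_diag_pos_interior_periodic R d k Lam p)) = I,
          locdims_on mu_pi setT = I,
          range (upper_locdim mu_pi) = I &
          range (lower_locdim mu_pi) = I])
  /\
  (forall (d k : nat) (p : 'I_k.+1 -> R)
      (mu : probability (measurableTypeR R) R),
    (3 <= d)%N -> (d.-1 <= k)%N ->
    (forall j, 0 < p j) -> \sum_j p j = 1 ->
    self_similar_measure d [set: 'I_k.+1]%SET p mu ->
    exists a b : R, a <= b /\
      locdims_on (quotient_measure mu) setT = EFin @` `[a, b]).
Proof.
split=> [d k Lam p K mu d3 dk L0 Lk p0 p1 _ ss Kc [w w0 wp]|d k p mu d3 dk p0 p1 ss].
  apply: locdim_spectrum_interval (cantor_like_col d3 Kc) _ => //.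
  exact: (block_positive_class d3 dk p0 w0 wp).
have [||||a [b [ab [_ h _ _]]]] := locdim_spectrum_interval d3 dk _ _ _ _ ss
    (full_col d3 dk) (full_class_positive (d_ge3 := d3) dk p0); rewrite ?inE //.
  by rewrite -[RHS]p1; apply: eq_bigl => j; rewrite inE.
by exists a, b.
Qed.
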